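(* For $n\in\mathbb N=\{1,2,\dots\}$ let $N_{\mathrm{ssl}}(n)$ be the number of isomorphism classes of slim, semimodular lattices with exactly $n$ elements. Let $p(h,k)$, $\widehat p(h,k)$, $i(h,k)$, $\widehat{\imath}(h,k)$ and $p^{\sim}(h,k)$ be the numbers defined in the context. Then $N_{\mathrm{ssl}}(n)$ is determined by the identity $$\sum_{j=0}^{\binom h2}p(h,j)\,x^j=\prod_{j=1}^h\sum_{t=0}^{j-1}x^t=\prod_{j=1}^h\frac{1-x^j}{1-x}$$ together with the following (recursive) formulas, which hold for all $n,h\in\mathbb N$ and $k\in\mathbb N_0=\{0,1,2,\dots\}$: $$N_{\mathrm{ssl}}(n)=\sum_{h=0}^{n-1}p^{\sim}(h,n-h-1),$$ $$p^{\sim}(h,k)=\frac12\sum_{s=1}^h\sum_{t=0}^k\bigl(\widehat p(s,t)+\widehat{\imath}(s,t)\bigr)\,p^{\sim}(h-s,k-t),$$ $$\widehat p(h,k)=p(h,k)-\sum_{s=1}^{h-1}\sum_{t=0}^k\widehat p(s,t)\,p(h-s,k-t),$$ $$i(h,k)=i(h-1,k)+\sum_{s=2}^h i(h-2,k-2s+3),$$ $$\widehat{\imath}(h,k)=i(h,k)-\sum_{s=1}^{h-1}\sum_{t=0}^k\widehat{\imath}(s,t)\,i(h-s,k-t),$$ with the initial values $$p^{\sim}(h,0)=p(h,0)=i(h,0)=1=\widehat p(1,0)=\widehat{\imath}(1,0)\quad\text{for } h\in\mathbb N_0,$$ $$p^{\sim}(h,k)=p(h,k)=\widehat p(h,k)=i(h,k)=\widehat{\imath}(h,k)=0\quad\text{if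 } k>\tbinom h2 \text{ or } \{h,k\}\not\subseteq\mathbb N_0,$$ $$\widehat p(h,0)=\widehat{\imath}(h,0)=0\quad\text{if } h>1.$$
   Context: All lattices are finite. An element of a lattice $L$ is (non-zero) join-irreducible if it is nonzero and is not the join of two strictly smaller elements; $\mathrm{Ji}\,L$ is the set of these elements. $L$ is slim if $\mathrm{Ji}\,L$ contains no three-element antichain (equivalently, $\mathrm{Ji}\,L$ is a union of two chains). $L$ is semimodular if for all $x,y,z\in L$, $x\preceq y$ implies $x\vee z\preceq y\vee z$, where $\preceq$ means ''covered by or equal''. $S_h$ is the set of permutations of $\{1,\dots,h\}$ ($S_0$ consists of the empty permutation only). More generally, for a finite set $A\subset\mathbb N$, $S_A$ is the set of permutations of $A$, with $A$ ordered as in $\mathbb N$. The number of inversions of a permutation $\sigma$ is $\mathrm{inv}(\sigma)=|\{(\sigma(a),\sigma(b)): a<b,\ \sigma(a)>\sigma(b)\}|$. Segments, head, body. Let $\pi\in S_h$ with $h\ge1$. A nonempty interval $I=[u,v]\subseteq\{1,\dots,h\}$ is a section of $\pi$ if $[1,u-1]$, $I$ and $[v+1,h]$ are all closed under $\pi$; the inclusion-minimal sections are called segments. The segment $I_1$ containing $1$ is the initial segment of $\pi$. Put $\mathrm{head}(\pi)=\pi|_{I_1}\in S_{I_1}$ and $\mathrm{body}(\pi)=\pi|_{\{1,\dots,h\}\setminus I_1}$ (possibly the empty permutation). $\pi$ is irreducible if its initial segment is $\{1,\dots,h\}$. The same notions apply to permutations of any nonempty finite interval $A$ of $\mathbb N$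 (with the least element of $A$ in place of $1$). Blocks. The block $[\pi]^{\sim}$ of $\pi$ is defined by induction on the degree (number of elements acted upon): the block of the empty permutation consists of itself only; if $\pi$ is irreducible, $[\pi]^{\sim}=\{\pi,\pi^{-1}\}$; otherwise $[\pi]^{\sim}=\{\sigma:\mathrm{head}(\sigma)\in\{\mathrm{head}(\pi),\mathrm{head}(\pi)^{-1}\}\text{ and }\mathrm{body}(\sigma)\in[\mathrm{body}(\pi)]^{\sim}\}$. The blocks form a partition of $S_h$, and all members of a block have the same number of inversions. For $h,k\in\mathbb N_0$: - $p(h,k)=|\{\pi\in S_h:\mathrm{inv}(\pi)=k\}|$; - $\widehat p(h,k)=|\{\pi\in S_h:\mathrm{inv}(\pi)=k,\ \pi\text{ irreducible}\}|$; - $i(h,k)=|\{\pi\in S_h:\mathrm{inv}(\pi)=k,\ \pi^2=\mathrm{id}\}|$; - $\widehat{\imath}(h,k)=|\{\pi\in S_h:\mathrm{inv}(\pi)=k,\ \pi^2=\mathrm{id},\ \pi\text{ irreducible}\}|$; - $p^{\sim}(h,k)=|\{[\pi]^{\sim}:\pi\in S_h,\ \mathrm{inv}(\pi)=k\}|$. All these functions are taken to be $0$ when an argument is not in $\mathbb N_0$. Also $\binom hk=0$ if $k>h$. *)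

(* Defs.v *)
From HB Require Import structures.
From mathcomp Require Import all_boot all_order all_fingroup all_algebra.

Set Implicit Arguments.
Unset Strict Implicit.
Unset Printing Implicit Defensive.

Import Order.TTheory GRing.Theory Num.Theory.

Section Lattices.
Local Open Scope order_scope.

Definition is_zero {d} {L : finLatticeType d} (x : L) : bool :=
  [forall y : L, x <= y].

Definition join_irreducible {d} {L : finLatticeType d} (x : L) : bool :=
  ~~ is_zero x &&
  ~~ [exists y : L, exists z : L, [&& y < x, z < x & x == y `|` z]].

(* The symbol "><" is incomparability, so x, y, z are distinct. *)
Definition slim {d} (L : finLatticeType d) : bool :=
  ~~ [exists x : L, exists y : L, exists z : L,
        [&& join_irreducible x, join_irreducible y, join_irreducible z,
            x >< y, y >< z & x >< z]].

Definition covered_by {d} {L : finLatticeType d} (x y : L) : bool :=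
  (x < y) && ~~ [exists z : L, x < z < y].

Definition covered_or_eq {d} {L : finLatticeType d} (x y : L) : bool :=
  (x == y) || covered_by x y.

Definition semimodular {d} (L : finLatticeType d) : bool :=
  [forall x : L, forall y : L, forall z : L,
     covered_or_eq x y ==> covered_or_eq (x `|` z) (y `|` z)].

Definition isomorphic {d d'} (L : finLatticeType d) (M : finLatticeType d') :
    bool :=
  [exists f : {ffun L -> M},
     [&& injectiveb f, [forall y : M, y \in codom f]
       & [forall x : L, forall y : L,
            (f (x `&` y) == f x `&` f y) && (f (x `|` y) == f x `|` f y)]]].

End Lattices.

(* A lattice structure on 'I_n is a pair (meet, join) of operations. *)
Definition binop (n : nat) : finType :=
  {ffun 'I_n -> {ffun 'I_n -> 'I_n}}.

Definition is_lattice (n : nat) (mj : binop n * binop n) : bool :=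
  let: (m, j) := mj in
  [&& [forall x, forall y, m x y == m y x],
      [forall x, forall y, j x y == j y x],
      [forall x, forall y, forall z, m x (m y z) == m (m x y) z],
      [forall x, forall y, forall z, j x (j y z) == j (j x y) z],
      [forall x, forall y, m x (j x y) == x]
    & [forall x, forall y, j x (m x y) == x]].

Definition lattice_on (n : nat) : finType :=
  {mj : binop n * binop n | is_lattice mj}.

(* The set 'I_n, regarded as a lattice by means of r. *)
Definition carrier (n : nat) (r : lattice_on n) : Type := 'I_n.

Fact carrier_display : Order.disp_t.
Proof. exact: Order.Disp tt tt. Qed.

Section CarrierLattice.
Context (n : nat) (r : lattice_on n).
Let m (x y : carrier r) : carrier r := (val r).1 x y.
Let j (x y : carrier r) : carrier r := (val r).2 x y.
Let le (x y : carrier r) : bool := m x y == x :> 'I_n.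

Let rP : [/\ commutative m, commutative j, associative m, associative j
  & (forall x y, m x (j x y) = x) /\ (forall x y, j x (m x y) = x)].
Proof.
have := valP r; rewrite /m /j; case: (val r) => a b /=.
case/and5P=> /forallP mC /forallP jC /forallP mA /forallP jA /andP[/forallP mK].
move=> /forallP jK; split; [| | | |split] => x y.
- exact/eqP/(forallP (mC x)).
- exact/eqP/(forallP (jC x)).
- by move=> z; apply/eqP/(forallP (forallP (mA x) y)).
- by move=> z; apply/eqP/(forallP (forallP (jA x) y)).
- exact/eqP/(forallP (mK x)).
- exact/eqP/(forallP (jK x)).
Qed.

Let mC : commutative m. Proof. by case: rP. Qed.
Let jC : commutative j. Proof. by case: rP. Qed.
Let mA : associative m. Proof. by case: rP. Qed.
Let jA : associative j. Proof. by case: rP. Qed.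
Let mK x y : m x (j x y) = x. Proof. by case: rP => ? ? ? ? []. Qed.
Let jK x y : j x (m x y) = x. Proof. by case: rP => ? ? ? ? []. Qed.

Let le_refl : reflexive le.
Proof. by move=> x; rewrite /le -{2}(jK x x) mK. Qed.

Let le_anti : antisymmetric le.
Proof. by move=> x y /andP[/eqP xy /eqP yx]; rewrite -[LHS]xy mC. Qed.

Let le_trans : transitive le.
Proof.
by move=> y x z /eqP xy /eqP yz; apply/eqP; rewrite -[in LHS]xy -mA yz.
Qed.

HB.instance Definition _ := Finite.copy (carrier r) 'I_n.
HB.instance Definition _ :=
  Order.Le_isPOrder.Build carrier_display (carrier r) le_refl le_anti le_trans.
HB.instance Definition _ :=
  Order.POrder_isLattice.Build carrier_display (carrier r)
    mC jC mA jA (fun y x => mK x y) (fun y x => jK x y) (fun _ _ => erefl).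

End CarrierLattice.

(* Every lattice with n elements is isomorphic to one on 'I_n, so that
   isomorphism classes may be counted there. *)
Lemma lattice_on_complete d (L : finLatticeType d) (n : nat) :
  #|L| = n -> exists r : lattice_on n, isomorphic L (carrier r).
Proof.
move=> <-.
pose a : binop #|L| :=
  [ffun x => [ffun y => enum_rank (enum_val x `&` enum_val y)%O]].
pose b : binop #|L| :=
  [ffun x => [ffun y => enum_rank (enum_val x `|` enum_val y)%O]].
have ab_lat : is_lattice (a, b).
  rewrite /is_lattice; apply/and5P; split; try (apply/andP; split);
    apply/forallP=> x; apply/forallP=> y;
    try (apply/forallP=> z); rewrite !ffunE ?enum_rankK.
  - by rewrite meetC.
  - by rewrite joinC.
  - by rewrite meetA.
  - by rewrite joinA.
  - by rewrite joinKI enum_valK.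
  - by rewrite meetKU enum_valK.
pose r : lattice_on #|L| := Sub (a, b) ab_lat.
exists r; apply/existsP.
exists ([ffun x => enum_rank x] : {ffun L -> carrier r}); apply/and3P; split.
- by apply/injectiveP=> x y; rewrite !ffunE => /enum_rank_inj.
- apply/forallP=> y; apply/codomP; exists (enum_val (y : 'I_#|L|)).
  by rewrite ffunE enum_valK.
- apply/forallP=> x; apply/forallP=> y; rewrite !ffunE; apply/andP; split.
    by apply/eqP; rewrite /Order.meet /= !ffunE !enum_rankK.
  by apply/eqP; rewrite /Order.join /= !ffunE !enum_rankK.
Qed.

Definition N_ssl (n : nat) : nat :=
  #|equivalence_partition
      (fun r s : lattice_on n => isomorphic (carrier r) (carrier s))
      [set r : lattice_on n | slim (carrier r) && semimodular (carrier r)]|.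

(* Permutations act on {0, ..., h-1} = 'I_h instead of {1, ..., h}.  A
   permutation of a subset A of 'I_h is represented by the permutation of 'I_h
   that extends it by the identity, together with A. *)
Section Permutations.
Context (h : nat).
Implicit Types (A I : {set 'I_h}) (s t : 'S_h).
Local Open Scope group_scope.

Definition num_inv s : nat :=
  #|[set (s p.1, s p.2) | p : 'I_h * 'I_h & (p.1 < p.2) && (s p.2 < s p.1)]|.

Definition closed_under s I : bool := [forall x in I, s x \in I].

Definition is_section A s I : bool :=
  [exists u : 'I_h, exists v : 'I_h,
     [&& u <= v, I == [set x : 'I_h | u <= x <= v], I \subset A,
         closed_under s [set x in A | x < u],
         closed_under s I
       & closed_under s [set x : 'I_h in A | v < x]]].

Definition is_segment A s I : bool := minset (is_section A s) I.

Definition has_least A I : bool :=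
  [exists x in I, [forall y in A, x <= y]].

(* Equal to set0 when A is empty. *)
Definition initial_segment A s : {set 'I_h} :=
  odflt set0 [pick I | is_segment A s I && has_least A I].

Definition irreducible A s : bool := (A != set0) && (initial_segment A s == A).

Definition perm_head A s : 'S_h := restr_perm (initial_segment A s) s.

Definition perm_body A s : 'S_h := restr_perm (A :\: initial_segment A s) s.

(* The induction is on an upper bound n of the degree #|A|.  Equality of heads
   includes equality of their domains, the initial segments. *)
Fixpoint block_rec (n : nat) A s : {set 'S_h} :=
  if n is n'.+1 then
    if A == set0 then [set s]
    else if irreducible A s then [set s; s^-1]
    else [set t | [&& perm_on A t,
                      initial_segment A t == initial_segment A s,
                      perm_head A t \in [set perm_head A s; (perm_head A s)^-1]
                    & perm_body A t \in block_rec n' (A :\: initial_segment A s)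
                                                (perm_body A s)]]
  else [set s].

Definition block s : {set 'S_h} := block_rec h [set: 'I_h] s.

End Permutations.

Section Numbers.
Local Open Scope group_scope.

Definition p (h k : nat) : nat := #|[set s : 'S_h | num_inv s == k]|.

Definition p_hat (h k : nat) : nat :=
  #|[set s : 'S_h | (num_inv s == k) && irreducible [set: 'I_h] s]|.

Definition i (h k : nat) : nat :=
  #|[set s : 'S_h | (num_inv s == k) && (s * s == 1)]|.

Definition i_hat (h k : nat) : nat :=
  #|[set s : 'S_h |
       [&& num_inv s == k, s * s == 1 & irreducible [set: 'I_h] s]]|.

Definition p_tilde (h k : nat) : nat :=
  #|[set block s | s : 'S_h & num_inv s == k]|.

End Numbers.

Local Open Scope ring_scope.

Definition extend_by_0 (f : nat -> nat -> nat) (h k : int) : rat :=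
  match h, k with
  | Posz h', Posz k' => (f h' k')%:R
  | _, _ => 0
  end.

(* The values lie in rat, so that neither the subtractions nor the factor 1/2
   are truncated. *)
Record ssl_recursion (N : nat -> rat) (p p_hat i i_hat p_tilde : int -> int -> rat)
    : Prop := SslRecursion {
  generating_function : forall h : nat, (0 < h)%N ->
    (\sum_(0 <= j < 'C(h, 2).+1) p h j *: 'X^j : {poly rat})
      = \prod_(1 <= j < h.+1) \sum_(0 <= t < j) 'X^t
    /\
    tofrac (\prod_(1 <= j < h.+1) \sum_(0 <= t < j) 'X^t : {poly rat})
      = \prod_(1 <= j < h.+1) (tofrac (1 - 'X^j) / tofrac (1 - 'X));

  N_formula : forall n : nat, (0 < n)%N ->
    N n = \sum_(0 <= h < n) p_tilde h (n%:Z - h%:Z - 1);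

  p_tilde_formula : forall h k : nat, (0 < h)%N ->
    p_tilde h k =
      1 / 2 * \sum_(1 <= s < h.+1) \sum_(0 <= t < k.+1)
        (p_hat s t + i_hat s t) * p_tilde (h%:Z - s%:Z) (k%:Z - t%:Z);

  p_hat_formula : forall h k : nat, (0 < h)%N ->
    p_hat h k =
      p h k - \sum_(1 <= s < h) \sum_(0 <= t < k.+1)
        p_hat s t * p (h%:Z - s%:Z) (k%:Z - t%:Z);

  i_formula : forall h k : nat, (0 < h)%N ->
    i h k =
      i (h%:Z - 1) k +
      \sum_(2 <= s < h.+1) i (h%:Z - 2) (k%:Z - 2 * s%:Z + 3);

  i_hat_formula : forall h k : nat, (0 < h)%N ->
    i_hat h k =
      i h k - \sum_(1 <= s < h) \sum_(0 <= t < k.+1)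
        i_hat s t * i (h%:Z - s%:Z) (k%:Z - t%:Z);

  initial_one : forall h : nat, p_tilde h 0 = 1 /\ p h 0 = 1 /\ i h 0 = 1;

  initial_one_hat : p_hat 1 0 = 1 /\ i_hat 1 0 = 1;

  vanishing_large : forall h k : nat, ('C(h, 2) < k)%N ->
    [/\ p_tilde h k = 0, p h k = 0, p_hat h k = 0, i h k = 0
      & i_hat h k = 0];

  vanishing_negative : forall h k : int, (h < 0) || (k < 0) ->
    [/\ p_tilde h k = 0, p h k = 0, p_hat h k = 0, i h k = 0
      & i_hat h k = 0];

  vanishing_hat : forall h : nat, (1 < h)%N -> p_hat h 0 = 0 /\ i_hat h 0 = 0
}.

(* Main.v *)
(** A slim semimodular lattice of length [h] has two maximal chains
    [c_0 < ... < c_h] and [e_0 < ... < e_h] that together contain all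
    join-irreducible elements (Dilworth's theorem for width two), so every element
    is some [c_i v e_j].  By semimodularity, [c_(i+1) <= c_i v e_j] holds exactly
    when [s i < j] for a permutation [s], and symmetrically
    [e_(j+1) <= c_i v e_j] exactly when [s^-1 j < i].  These conditions, called a
    chart below, determine the order on the joins [c_i v e_j], hence the lattice;
    conversely each [s] is realized by the lattice of its closed pairs [(i, j)],
    which has [h + 1 + inv s] elements.  Two charts of one lattice can only differ
    by exchanging the two chains between consecutive cutpoints [c_m = e_m], because
    inside such an interval the chains are rebuilt from bottom to top in a unique
    way; exchanging them inverts [s] on the corresponding segment, so isomorphism
    classes are blocks.  The recursions come from splitting off the first segment
    of a permutation, and from deleting [0] (and its image) from a permutation or
    an involution. *)

From HB Require Import structures.
Require Import Defs.
From mathcomp Require Import all_boot all_order all_fingroup all_algebra.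
From mathcomp Require Import zify.

Import Order.TTheory GRing.Theory Num.Theory.

Set Implicit Arguments.
Unset Strict Implicit.
Unset Printing Implicit Defensive.

(** * Cuts, segments and blocks *)

(** Blocks are defined by recursion on restrictions of a permutation to subsets, a form that
    lattices do not see. They are replaced by the relation [sim], stated at once for the whole
    permutation: a Boolean function [F] on positions, constant on every segment, tells where [s] is
    replaced by its inverse. The same [F] acts on a chart, by exchanging the two chains at the
    levels it marks, and such an [F] can be read off from any two charts of one lattice. So both
    directions between isomorphism and blocks become statements about [F]. That similar permutations
    have equally many inversions is not shown by counting pairs: it follows by comparing the
    cardinalities of their lattices. The factor 1/2 in the recursion for blocks comes from the
    heads: a class of a permutation and its inverse has two members unless the permutation is an
    involution, so counting all irreducible permutations once and the irreducible involutions once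
    more counts every class twice. *)

Section Cuts.
Local Open Scope group_scope.
Context (h : nat).
Implicit Types (s t : 'S_h) (F : nat -> bool).

(** Cuts up to [h] are the end points of the segments. As 0 and every [m >= h] are cuts, [m] can
    range over all of [nat]. *)
Definition cut s (m : nat) : bool := [forall i : 'I_h, (i < m) ==> (s i < m)].

Lemma cutP s m : reflect (forall i : 'I_h, i < m -> s i < m) (cut s m).
Proof. by apply: (iffP forallP) => H i; apply/implyP/H. Qed.

Lemma cut0 s : cut s 0.
Proof. exact/cutP. Qed.

Lemma cut_ge s m : h <= m -> cut s m.
Proof. by move=> hm; apply/cutP => i _; apply: leq_trans (ltn_ord _) hm. Qed.

(** An injective map of a finite initial interval into itself is onto, so nothing from outside can
    enter the interval. *)
Lemma cut_ltE s m (i : 'I_h) : cut s m -> (s i < m) = (i < m).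
Proof.
move/cutP=> sm; apply/idP/idP => [|/sm//].
have sub : [set s x | x in [set x : 'I_h | x < m]] \subset [set x : 'I_h | x < m].
  by apply/subsetP=> _ /imsetP[x + ->]; rewrite !inE; apply: sm.
have /eqP eqA : [set s x | x in [set x : 'I_h | x < m]] == [set x : 'I_h | x < m].
  by rewrite eqEcard sub (card_imset _ (@perm_inj _ s)) leqnn.
move=> sim; have : s i \in [set x : 'I_h | x < m] by rewrite inE.
by rewrite -eqA (mem_imset _ _ (@perm_inj _ s)) inE.
Qed.

Lemma cutV s m : cut s^-1 m = cut s m.
Proof.
by apply/idP/idP => sm; apply/cutP => i im;
  rewrite -(cut_ltE _ sm) ?permK ?permKV.
Qed.

Lemma cut_ltVE s m (i : 'I_h) : cut s m -> (s^-1 i < m) = (i < m).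
Proof. by move=> sm; rewrite cut_ltE ?cutV. Qed.

(** Positions [m] and [m.+1] lie in the same segment unless [m.+1] is a cut; hence this says that
    [F] is constant on each segment. *)
Definition cut_constant s F := forall m, ~~ cut s m.+1 -> F m.+1 = F m.

Lemma cut_constantP s F i j :
  cut_constant s F -> F i != F j -> i <= j -> exists m, i < m <= j /\ cut s m.
Proof.
move=> Fs; elim: j => [|j IH]; first by case: i; rewrite ?eqxx.
move=> Fij; rewrite leq_eqVlt => /predU1P[ij|ij]; first by rewrite ij eqxx in Fij.
have [sj|/Fs Fj] := boolP (cut s j.+1); first by exists j.+1; rewrite ij leqnn.
rewrite Fj in Fij; have [m [/andP[im mj] sm]] := IH Fij ij.
by exists m; rewrite im leqW.
Qed.

Lemma cut_constant_perm s F (i : 'I_h) : cut_constant s F -> F (s i) = F i.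
Proof.
move=> Fs; apply/eqP/negPn/negP => Fij.
have [le|/ltnW le] := leqP (s i) i.
  have [m [/andP[im mj] sm]] := cut_constantP Fs Fij le.
  by have := cut_ltE i sm; lia.
rewrite eq_sym in Fij; have [m [/andP[im mj] sm]] := cut_constantP Fs Fij le.
by have := cut_ltE i sm; lia.
Qed.

(** The segments marked by [F] are inverted. This is the relation behind blocks, without recursion
    on head and body. *)
Definition flips F s t : Prop :=
  cut_constant s F /\ forall i, t i = if F i then s^-1 i else s i.

Lemma flips_cut F s t m : flips F s t -> cut t m = cut s m.
Proof.
move=> [Fs tE]; have st u : cut s u -> cut t u.
  by move=> su; apply/cutP => i iu; rewrite tE; case: ifP; rewrite ?cut_ltVE ?cut_ltE.
apply/idP/idP; last exact: st.
(* Where [F] holds, [t] maps [s i] back to [i]. *)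
move=> tm; apply/cutP => i im; case Fi: (F i); last first.
  by rewrite -[s i](_ : t i = _) ?cut_ltE // tE Fi.
have /= := cut_ltE (s i) tm.
by rewrite tE cut_constant_perm // Fi permK im => <-.
Qed.

Lemma flipsV F s t (i : 'I_h) : flips F s t -> t^-1 i = if F i then s i else s^-1 i.
Proof.
move=> [Fs tE]; apply: (@perm_inj _ t); rewrite permKV tE.
case Fi: (F i); first by rewrite cut_constant_perm // Fi permK.
by rewrite -(cut_constant_perm _ Fs) permKV Fi.
Qed.

Lemma flips_sym F s t : flips F s t -> flips F t s.
Proof.
move=> Fst; split=> [m|i].
  by rewrite (flips_cut _ Fst); apply: (proj1 Fst).
by rewrite (flipsV i Fst) (proj2 Fst); case: (F i).
Qed.

Definition sim s t : Prop := exists F, flips F s t.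

Lemma sim_refl s : sim s s.
Proof. by exists xpred0; split. Qed.

Lemma sim_sym s t : sim s t -> sim t s.
Proof. by case=> F /flips_sym; exists F. Qed.

(** Inverting a segment twice restores it, so the markings are added modulo 2. *)
Lemma sim_trans s t r : sim s t -> sim t r -> sim s r.
Proof.
case=> F Fst [G Gtr]; exists (fun m => F m (+) G m); split=> [m sm|i].
  by rewrite (proj1 Fst) // (proj1 Gtr) ?(flips_cut _ Fst).
by rewrite (proj2 Gtr) (flipsV i Fst) (proj2 Fst); case: (F i); case: (G i).
Qed.

Lemma simV s : sim s s^-1.
Proof. by exists xpredT; split. Qed.

Lemma sim_cut s t m : sim s t -> cut t m = cut s m.
Proof. by case=> F /flips_cut. Qed.

Local Notation from u := [set x : 'I_h | u <= x].

Lemma perm_on_cut u s m : perm_on (from u) s -> m <= u -> cut s m.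
Proof.
move=> su mu; apply/cutP => i im; rewrite (out_perm su) // inE -ltnNge.
exact: leq_trans mu.
Qed.

Lemma sim_perm_on u s t : perm_on (from u) s -> sim s t -> perm_on (from u) t.
Proof.
move=> su [F [_ tE]]; apply/subsetP => x; rewrite !inE tE leqNgt; apply: contra.
move=> xu; have sx : s x = x by apply: (out_perm su); rewrite inE -ltnNge.
by case: ifP => _; rewrite ?sx // -{1}sx permK.
Qed.

(** Since [s] is the identity below [u], closure of the three parts relative to [from u] becomes the
    condition that both ends of the interval are cuts of the whole permutation. *)
Lemma sectionP u s I : perm_on (from u) s ->
  reflect (exists a b, [/\ a < b <= h, u <= a, cut s a, cut s b
                         & I = [set x : 'I_h | a <= x < b]])
          (is_section (from u) s I).
Proof.
move=> su; have out (x : 'I_h) : x < u -> s x = x.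
  by move=> xu; apply: (out_perm su); rewrite inE -ltnNge.
have sin (x : 'I_h) : (u <= s x) = (u <= x).
  by have := perm_closed x su; rewrite !inE.
apply: (iffP existsP) => [[a /existsP[b /and5P[ab /eqP-> sub c1 /andP[c2 c3]]]]|].
  have ua : u <= a.
    by have := subsetP sub a; rewrite !inE leqnn ab; apply.
  have sa : cut s a.
    apply/cutP => x xa; have [/out->//|ux] := ltnP x u.
    have := forallP c1 x; rewrite !inE xa ux /= => /andP[_]; exact.
  exists a, b.+1; split=> //; first by rewrite ltnS ab ltn_ord.
  apply/cutP => x; rewrite !ltnS => xb.
  have [/(cutP _ _ sa) xa|ax] := ltnP x a.
    by rewrite ltnW // (leq_trans xa).
  by have := forallP c2 x; rewrite !inE ax xb /= => /andP[].
move=> [a [b [/andP[ab bh] ua sa sb ->]]].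
have ah : a < h := leq_trans ab bh.
case: b ab bh sb => // b; rewrite ltnS => ab bh sb.
exists (Ordinal ah); apply/existsP; exists (Ordinal bh); rewrite ab /=.
apply/and5P; split=> //.
- by apply/subsetP => x; rewrite !inE; lia.
- apply/forallP => x; apply/implyP; rewrite !inE sin => /andP[-> /=].
  by rewrite cut_ltE.
- apply/forallP => x; apply/implyP; rewrite !inE !(leqNgt a).
  by rewrite !(cut_ltE _ sa) !(cut_ltE _ sb).
- apply/forallP => x; apply/implyP; rewrite !inE sin => /andP[-> /=].
  by rewrite !(leqNgt b.+1) !(cut_ltE _ sb).
Qed.

Lemma next_cut s u : u < h ->
  {v | [/\ u < v <= h, cut s v & forall m, u < m < v -> ~~ cut s m]}.
Proof.
move=> uh; have ex : exists v, (u < v) && cut s v by exists h; rewrite uh cut_ge.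
exists (ex_minn ex); case: ex_minnP => v /andP[uv sv] min; split=> //.
  by rewrite uv min // uh cut_ge.
move=> m /andP[um mv]; apply/negP => sm.
by have := min m; rewrite um sm leqNgt mv => /(_ isT).
Qed.

(** A section containing [u] has to begin at [u], and its right end is a cut, hence not before
    [v]. *)
Lemma initial_segmentE u v s : perm_on (from u) s -> u < v <= h -> cut s v ->
  (forall m, u < m < v -> ~~ cut s m) ->
  initial_segment (from u) s = [set x : 'I_h | u <= x < v].
Proof.
move=> su /andP[uv vh] sv nocut; rewrite /initial_segment.
have uh : u < h := leq_trans uv vh.
have sec : is_section (from u) s [set x : 'I_h | u <= x < v].
  by apply/(sectionP _ su); exists u, v; rewrite uv leqnn (perm_on_cut su).
have sub I : is_section (from u) s I -> Ordinal uh \in I ->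
    [set x : 'I_h | u <= x < v] \subset I.
  move=> /(sectionP _ su)[a [b [/andP[ab bh] ua sa sb ->]]].
  rewrite inE /= => /andP[au ub]; apply/subsetP => x; rewrite !inE => /andP[ux xv].
  rewrite (leq_trans au ux) /=; apply: (leq_trans xv).
  by rewrite leqNgt; apply/negP => bv; have := nocut b; rewrite ub bv sb => /(_ isT).
case: pickP => [I|none] /=.
  case/andP=> segI /existsP[x /andP[xI /forallP le]].
  have Ix : Ordinal uh \in I.
    have secI := minsetp segI; have [a [b [_ ua _ _ IE]]] := sectionP _ su secI.
    have := le (Ordinal uh); rewrite inE leqnn /= => xu.
    suff <- : x = Ordinal uh by [].
    by apply/val_inj/eqP; rewrite /= eqn_leq xu; move: xI; rewrite IE inE; lia.
  by rewrite -(minsetinf segI sec) // sub // (minsetp segI).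
have := none [set x : 'I_h | u <= x < v]; move/negP; case; apply/andP; split.
  apply/minsetP; split=> // J secJ subJ; apply/eqP; rewrite eqEsubset subJ sub //.
  have [a [b [/andP[ab bh] ua sa sb JE]]] := sectionP _ su secJ.
  (* A smaller section that began later would have its left end as a cut strictly between [u] and
     [v]. *)
  suff au : a = u by rewrite JE inE /= au leqnn -au ab.
  apply/eqP; rewrite eqn_leq ua andbT leqNgt; apply/negP => lt.
  have ah : a < h := leq_trans ab bh.
  have := subsetP subJ (Ordinal ah); rewrite JE !inE /= leqnn ab => /(_ isT) /andP[_ av].
  by have := nocut a; rewrite lt av sa => /(_ isT).
apply/existsP; exists (Ordinal uh); rewrite inE leqnn /= uv.
by apply/forallP => y; rewrite inE; apply/implyP.
Qed.

Lemma from0 : from 0 = [set: 'I_h].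
Proof. by apply/setP => x; rewrite !inE. Qed.

Lemma from_eq0 u : (from u == set0) = (h <= u).
Proof.
apply/eqP/idP => [E|hu]; last first.
  by apply/setP => x; rewrite !inE; apply/negbTE; rewrite -ltnNge (leq_trans _ hu).
by rewrite leqNgt; apply/negP => uh; have /setP/(_ (Ordinal uh)) := E; rewrite !inE leqnn.
Qed.

Lemma irreducible_fromE u v s : perm_on (from u) s -> u < v <= h -> cut s v ->
  (forall m, u < m < v -> ~~ cut s m) -> irreducible (from u) s = (v == h).
Proof.
move=> su uvh sv nocut; rewrite /irreducible (initial_segmentE su uvh) // from_eq0.
case/andP: uvh => uv vh.
rewrite -ltnNge (leq_trans uv vh) /=; apply/eqP/eqP => [/setP E|->].
  apply/eqP; rewrite eqn_leq vh leqNgt; apply/negP => lt.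
  by have := E (Ordinal lt); rewrite !inE /= ltnn andbF ltnW.
by apply/setP => x; rewrite !inE ltn_ord andbT.
Qed.

Lemma irreducibleE s :
  irreducible [set: 'I_h] s = (0 < h) && [forall m : 'I_h, (0 < m) ==> ~~ cut s m].
Proof.
rewrite -from0; case: (posnP h) => h0.
  by rewrite /irreducible from_eq0 (_ : h <= 0) ?h0.
have s0 : perm_on (from 0) s by apply/subsetP => x; rewrite !inE.
have [v [uvh sv nocut]] := next_cut s h0.
rewrite (irreducible_fromE s0 uvh sv nocut) /=; case/andP: (uvh) => v0 vh.
apply/eqP/forallP => [vE m|H].
  by apply/implyP => m0; apply: nocut; rewrite m0 vE /=.
apply/eqP; rewrite eqn_leq vh leqNgt; apply/negP => lt.
by have := H (Ordinal lt); rewrite /= v0 sv.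
Qed.

Lemma restr_perm_fun (B : {set 'I_h}) s : (forall x, (s x \in B) = (x \in B)) ->
  forall x, restr_perm B s x = if x \in B then s x else x.
Proof.
move=> sB x; case: ifP => xB.
  by apply: restr_permE => //; apply/astabsP => y; apply: sB.
by apply: (out_perm (restr_perm_on B s)); rewrite xB.
Qed.

Lemma restr_permV_fun (B : {set 'I_h}) s : (forall x, (s x \in B) = (x \in B)) ->
  forall x, (restr_perm B s)^-1 x = if x \in B then s^-1 x else x.
Proof.
move=> sB x; apply: (@perm_inj _ (restr_perm B s)); rewrite permKV restr_perm_fun //.
have [xB|xNB] := boolP (x \in B); last by rewrite (negPf xNB).
by rewrite -sB permKV xB.
Qed.

Lemma segment_stable s u v : cut s u -> cut s v ->
  forall x : 'I_h, (s x \in [set x : 'I_h | u <= x < v]) = (x \in [set x : 'I_h | u <= x < v]).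
Proof. by move=> su sv x; rewrite !inE !(leqNgt u) !(cut_ltE _ su) !(cut_ltE _ sv). Qed.

Lemma from_stable s v : cut s v ->
  forall x : 'I_h, (s x \in from v) = (x \in from v).
Proof. by move=> sv x; rewrite !inE !(leqNgt v) !(cut_ltE _ sv). Qed.

Lemma cut_constant_segment s F u v : cut_constant s F ->
  (forall m, u < m < v -> ~~ cut s m) -> forall x, u <= x < v -> F x = F u.
Proof.
move=> Fs nocut x /andP[ux xv]; apply/eqP/negPn/negP => Fxu; rewrite eq_sym in Fxu.
have [m [/andP[um mx] sm]] := cut_constantP Fs Fxu ux.
by have := nocut m; rewrite um sm (leq_ltn_trans mx xv) => /(_ isT).
Qed.

Lemma perm_on_from_ge u s : h <= u -> perm_on (from u) s -> s = 1.
Proof.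
rewrite -from_eq0 => /eqP-> s1; apply/permP => x; rewrite perm1.
by apply: (out_perm s1); rewrite inE.
Qed.

Lemma sim_segment u v s t F : flips F s t ->
  (forall m, u < m < v -> ~~ cut s m) ->
  {in [set x : 'I_h | u <= x < v], t =1 if F u then s^-1 else s}.
Proof.
move=> [Fs tE] nocut x; rewrite inE => xuv.
by rewrite tE (cut_constant_segment Fs nocut xuv); case: ifP.
Qed.

(** Every recursive call acts on a final interval, so its state is described by [u], and
    [h <= u + n] says that the fuel [n] suffices. If the next cut [v] is below [h], similarity
    splits into a choice between [s] and its inverse on the positions from [u] to [v] and similarity
    of the bodies on [from v]. *)
Lemma block_recP n u s t : h <= u + n -> perm_on (from u) s ->
  reflect (sim s t) (t \in block_rec n (from u) s).
Proof.
have triv u' s' t' : h <= u' -> perm_on (from u') s' -> reflect (sim s' t') (t' \in [set s']).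
  move=> hu su; rewrite inE; apply: (iffP eqP) => [->|st]; first exact: sim_refl.
  by rewrite (perm_on_from_ge hu su) (perm_on_from_ge hu (sim_perm_on su st)).
elim: n => [|n IH] in u s t * => hun su /=; first by apply: (triv u) => //; lia.
rewrite from_eq0; have [hu|uh] := leqP h u; first exact: triv hu su.
have [v [uvh sv nocut]] := next_cut s uh; have /andP[uv vh] := uvh.
rewrite (irreducible_fromE su uvh sv nocut); have [vE|vNh] := eqVneq v h.
  rewrite !inE; apply: (iffP orP) => [[]/eqP->|[F Fst]].
  - exact: sim_refl.
  - exact: simV.
  have tE := sim_segment Fst nocut; rewrite vE in tE.
  have tu := sim_perm_on su (ex_intro _ F Fst).
  suff -> : t = if F u then s^-1 else s by case: ifP; [right|left].
  apply/permP => x; have [ux|xu] := leqP u x; first by rewrite tE // inE ux /=.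
  have xNu : x \notin from u by rewrite inE -ltnNge.
  rewrite (out_perm tu) //; case: ifP => _; rewrite (out_perm _ xNu) //.
  by rewrite perm_onV.
rewrite (initial_segmentE su uvh sv nocut).
have diffE : from u :\: [set x : 'I_h | u <= x < v] = from v.
  by apply/setP => x; rewrite !inE; lia.
rewrite diffE inE /perm_head /perm_body (initial_segmentE su uvh sv nocut) diffE.
have su' := perm_on_cut su (leqnn u).
have hs := restr_perm_fun (segment_stable su' sv).
have bs := restr_perm_fun (from_stable sv).
have simB r : reflect (sim (restr_perm (from v) s) r)
    (r \in block_rec n (from v) (restr_perm (from v) s)).
  by apply: IH; [lia | apply: restr_perm_on].
have hVE := restr_permV_fun (segment_stable su' sv).
have bVE := restr_permV_fun (from_stable sv).
have bcut m : v <= m -> cut (restr_perm (from v) s) m = cut s m.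
  move=> vm; apply/cutP/cutP => sm x xm; have := sm x xm; rewrite bs.
    case: ifP; rewrite // inE => /negbT; rewrite -ltnNge => xv _.
    by apply: leq_trans vm; rewrite cut_ltE.
  by case: ifP.
apply: (iffP and4P) => [[tu /eqP segt]|st].
  have [w [uwh tw nocutt]] := next_cut t uh; have /andP[uw wh] := uwh.
  have wv : w = v.
    move: segt; rewrite (initial_segmentE tu uwh tw nocutt) => /setP E.
    apply/eqP; rewrite eqn_leq; apply/andP; split; rewrite leqNgt; apply/negP => lt.
      have vh' : v < h := leq_trans lt wh.
      by have := E (Ordinal vh'); rewrite !inE /= lt ltnn (ltnW uv).
    have wh' : w < h := leq_trans lt vh.
    by have := E (Ordinal wh'); rewrite !inE /= lt ltnn (ltnW uw).
  rewrite {w uwh uw wh}wv in tw nocutt; rewrite segt diffE => head /simB[F [Fs tE]].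
  have tu' := perm_on_cut tu (leqnn u).
  have ht := restr_perm_fun (segment_stable tu' tw).
  have bt := restr_perm_fun (from_stable tw).
  set h1 := restr_perm _ t in head ht; set h2 := restr_perm _ s in head hs hVE.
  have vh' : v < h by lia.
  (* On the initial segment [t] agrees with [s] or with its inverse, and comparing the heads tells
     which; if both hold, [s] is kept. Below [u] both permutations are the identity, so any value is
     right there. *)
  pose G m := if m < v then h1 != h2 else F m; exists G; split=> [m|x].
    rewrite /G => sm; case: (ltngtP m.+1 v) => // mv.
      by apply: Fs; rewrite bcut // ltnW.
    by rewrite mv sv in sm.
  rewrite /G; have [xv|vx] := ltnP x v; last first.
    have xF : x \in from v by rewrite inE.
    by have := tE x; rewrite bt bVE bs xF.
  have [ux|xu] := leqP u x; last first.
    have xN : x \notin from u by rewrite inE -ltnNge.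
    by rewrite (out_perm tu) //; case: ifP => _; rewrite (out_perm _ xN) ?perm_onV.
  have xI : x \in [set x : 'I_h | u <= x < v] by rewrite inE ux.
  have := ht x; rewrite xI => <-; move: head; rewrite !inE => /orP[/eqP->|/eqP hE].
    by rewrite eqxx hs xI.
  case: eqVneq => [->|_]; first by rewrite hs xI.
  by rewrite hE hVE xI.
have tu := sim_perm_on su st; have [F Fst] := st; have ct m := flips_cut m Fst.
have tv : cut t v by rewrite ct.
have nocutt m : u < m < v -> ~~ cut t m by rewrite ct; apply: nocut.
rewrite (initial_segmentE tu uvh tv nocutt) diffE.
have tu' := perm_on_cut tu (leqnn u).
have ht := restr_perm_fun (segment_stable tu' tv).
have bt := restr_perm_fun (from_stable tv).
split=> //.
  rewrite !inE; have tE := sim_segment Fst nocut.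
  case Fu: (F u) tE => tE; [apply/orP; right|apply/orP; left]; apply/eqP/permP => x.
    by rewrite ht hVE; case: ifP => // /tE.
  by rewrite ht hs; case: ifP => // /tE.
apply/simB; exists F; split=> [m|x].
  have [vm|] := leqP v m.+1; first by rewrite bcut //; apply: (proj1 Fst).
  by move=> /ltnW mv; rewrite (perm_on_cut (restr_perm_on _ _)).
by rewrite bt bVE bs; case: ifP => _; [apply: (proj2 Fst) | case: ifP].
Qed.

Lemma blockP s t : reflect (sim s t) (t \in block s).
Proof.
by rewrite /block -from0; apply: block_recP => //; apply/subsetP => x; rewrite !inE.
Qed.

Lemma block_eqP s t : reflect (sim s t) (block s == block t).
Proof.
apply: (iffP eqP) => [E|st].
  by apply/blockP; rewrite E; apply/blockP/sim_refl.
apply/setP => r; apply/blockP/blockP => H; last exact: sim_trans H.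
exact: sim_trans (sim_sym st) H.
Qed.

End Cuts.

(** * Dilworth's theorem for width two *)

Section OrderLemmas.
Local Open Scope order_scope.

Lemma exists_maximal d (T : finPOrderType d) (A : {set T}) (x : T) :
  x \in A -> exists2 y, y \in A & forall z, z \in A -> ~~ (y < z).
Proof.
move=> xA; case: (arg_maxnP (fun y => #|[set z | z <= y]|) xA) => y yA ymax.
exists y => // z zA; apply/negP => yz; have := ymax z zA.
apply/negP; rewrite -ltnNge; apply: proper_card; apply/properP; split.
  by apply/subsetP => w; rewrite !inE => /le_trans->//; apply: ltW.
by exists z; rewrite !inE ?lexx // lt_geF.
Qed.

Lemma exists_minimal d (T : finPOrderType d) (A : {set T}) (x : T) :
  x \in A -> exists2 y, y \in A & forall z, z \in A -> ~~ (z < y).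
Proof.
move=> xA; case: (arg_minnP (fun y => #|[set z | z <= y]|) xA) => y yA ymin.
exists y => // z zA; apply/negP => zy; have := ymin z zA.
apply/negP; rewrite -ltnNge; apply: proper_card; apply/properP; split.
  by apply/subsetP => w; rewrite !inE => /le_trans->//; apply: ltW.
by exists y; rewrite !inE ?lexx // lt_geF.
Qed.

Definition chain_set d (T : porderType d) (A : pred T) :=
  forall x y, A x -> A y -> x >=< y.

(* Galvin's proof: induction on the removal of a maximal element [a]. *)
Lemma dilworth2 d (T : finPOrderType d) (J : {set T}) :
  (forall x y z, x \in J -> y \in J -> z \in J -> ~~ [&& x >< y, y >< z & x >< z]) ->
  exists A B : {set T}, [/\ J = A :|: B, chain_set (mem A) & chain_set (mem B)].
Proof.
have [n] := ubnP #|J|; elim: n J => // n IH J; rewrite ltnS => Jn width.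
have [->|[x0 /exists_maximal[a aJ amax]]] := set_0Vmem J.
  by exists set0, set0; rewrite setU0; split=> // x y; rewrite /= inE.
have [|x y z /setD1P[_ xJ] /setD1P[_ yJ] /setD1P[_ zJ]|A [B [JE chA chB]]] := IH (J :\ a).
- by apply: leq_trans Jn; rewrite [leqRHS](cardsD1 a) aJ.
- exact: width.
have sub x : x \in A :|: B -> x \in J by rewrite -JE => /setD1P[].
have sub' x : x \in J -> x != a -> x \in A :|: B by move=> xJ xa; rewrite -JE !inE xa.
have [/forallP pw|] := boolP [forall x in A, forall y in B, x >=< y].
  exists (A :|: B), [set a]; split; first by rewrite -JE setUC setD1K.
    move=> x y; rewrite /= !inE => /orP[xA|xB] /orP[yA|yB]; [exact: chA| | |exact: chB].
      by have := pw x; rewrite xA => /forallP/(_ y); rewrite yB.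
    by rewrite comparable_sym; have := pw y; rewrite yA => /forallP/(_ x); rewrite xB.
  by move=> x y; rewrite /= !inE => /eqP-> /eqP->; apply: comparablexx.
case/forallPn => x; rewrite negb_imply => /andP[xA /forallPn[y]].
rewrite negb_imply => /andP[yB xy].
(* [A'] and [B'] consist of the elements lying in an antichain with one member in each chain. Their
   top elements [x1] and [x2] are incomparable; as [x1], [x2], [a] is no antichain, the maximal
   element [a] lies above one of them. *)
pose A' := [set x in A | [exists y in B, x >< y]].
pose B' := [set y in B | [exists x in A, x >< y]].
have xA' : x \in A' by rewrite inE xA; apply/existsP; exists y; rewrite yB.
have yB' : y \in B' by rewrite inE yB; apply/existsP; exists x; rewrite xA.
have [x1 x1A' x1max] := exists_maximal xA'; have [x2 x2B' x2max] := exists_maximal yB'.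
move: (x1A') (x2B'); rewrite !inE => /andP[x1A /existsP[y1 /andP[y1B xy1]]].
move=> /andP[x2B /existsP[y2 /andP[y2A xy2]]].
have y1x2 : y1 <= x2.
  have y1B' : y1 \in B' by rewrite inE y1B; apply/existsP; exists x1; rewrite x1A.
  have := x2max _ y1B'; have /= := chB _ _ y1B x2B.
  by move=> /comparable_leNgt->.
have y2x1 : y2 <= x1.
  have y2A' : y2 \in A' by rewrite inE y2A; apply/existsP; exists x2; rewrite x2B.
  have := x1max _ y2A'; have /= := chA _ _ y2A x1A.
  by move=> /comparable_leNgt->.
have x12 : x1 >< x2.
  rewrite /Order.comparable; apply/norP; split; apply/negP => le.
    by move: xy2; rewrite /Order.comparable (le_trans y2x1 le).
  by move: xy1; rewrite /Order.comparable (le_trans y1x2 le) orbT.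
have x1J : x1 \in J by apply: sub; rewrite inE x1A.
have x2J : x2 \in J by apply: sub; rewrite inE x2B orbT.
have below z : z \in J -> z >=< a -> z <= a.
  by move=> zJ /comparable_leNgt->; apply: amax.
(* [a] is put on top of the part of [C] below [z]. The elements of [C] not below [z] are comparable
   with all of [D] by the choice of [z], so together with [D] they form a chain. *)
have rest C D z : C :|: D = A :|: B -> chain_set (mem C) -> chain_set (mem D) ->
    z <= a -> z \in C ->
    (forall x y, x \in C -> y \in D -> ~~ (x >=< y) -> x <= z) ->
    exists A B : {set T}, [/\ J = A :|: B, chain_set (mem A) & chain_set (mem B)].
  move=> CD chC chD za zC zmax.
  exists (a |: [set w in C | w <= z]), ([set w in C | ~~ (w <= z)] :|: D); split.
  - rewrite -(setD1K aJ) JE -CD; apply/setP => w; rewrite !inE.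
    by case: (w == a) (w \in C) (w \in D) (w <= z) => [] [] [] [].
  - move=> v w; rewrite /= !inE => /predU1P[->|/andP[vC vz]] /predU1P[->|/andP[wC wz]].
    + exact: comparablexx.
    + by rewrite /Order.comparable (le_trans wz za) orbT.
    + by rewrite /Order.comparable (le_trans vz za).
    + exact: chC.
  move=> v w; rewrite /= !inE => /orP[/andP[vC vz]|vD] /orP[/andP[wC wz]|wD].
  - exact: chC.
  - by apply/negPn/negP => /(zmax _ _ vC wD); apply/negP.
  - by rewrite comparable_sym; apply/negPn/negP => /(zmax _ _ wC vD); apply/negP.
  - exact: chD.
have := width _ _ _ x1J x2J aJ; rewrite x12 /= negb_and !negbK.
case/orP => /below lea.
  apply: (rest B A x2) => //; [by rewrite setUC|exact: lea|] => v w vB wA vw.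
  have vB' : v \in B'.
    by rewrite inE vB; apply/existsP; exists w; rewrite wA comparable_sym.
  have := x2max _ vB'; have /= := chB _ _ vB x2B.
  by move=> /comparable_leNgt->.
apply: (rest A B x1) => //; [exact: lea|] => v w vA wB vw.
have vA' : v \in A' by rewrite inE vA; apply/existsP; exists w; rewrite wB.
have := x1max _ vA'; have /= := chA _ _ vA x1A.
by move=> /comparable_leNgt->.
Qed.

End OrderLemmas.

(** * Maximal chains in semimodular lattices *)

Section MaximalChains.
Local Open Scope order_scope.
Context d (L : finLatticeType d).
Implicit Types (x y z : L) (c e : nat -> L).

Lemma coveredP x y : reflect (x < y /\ forall z, x < z -> z <= y -> z = y) (covered_by x y).
Proof.
apply: (iffP andP) => -[xy H]; split=> //.
  move=> z xz zy; apply/eqP/negPn/negP => zNy; case/negP: H; apply/existsP; exists z.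
  by rewrite xz lt_neqAle zNy.
by apply/existsP => -[z /andP[xz zy]]; move: (zy); rewrite (H z xz (ltW zy)) ltxx.
Qed.

Lemma semimodularP : semimodular L -> forall x y z, covered_or_eq x y ->
  covered_or_eq (x `|` z) (y `|` z).
Proof. by move=> /forallP H x y z; have /forallP/(_ y)/forallP/(_ z)/implyP := H x. Qed.

Lemma covered_or_eq_between x y z : covered_or_eq x y -> x <= z -> z <= y ->
  z = x \/ z = y.
Proof.
case/predU1P=> [->|/coveredP[_ H]] xz zy; first by left; apply/le_anti/andP.
by move: xz; rewrite le_eqVlt => /predU1P[->|/H->//]; [left|right].
Qed.

(** Chains are indexed by all of [nat]; monotonicity together with [max_chain_top] makes them
    constant from [m] on. *)
Record max_chain (m : nat) (c : nat -> L) : Prop := MaxChain {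
  max_chain_bot : forall x, c 0%N <= x;
  max_chain_top : forall x, x <= c m;
  max_chain_leS : forall i, c i <= c i.+1;
  max_chain_cov : forall i, (i < m)%N -> covered_by (c i) (c i.+1)
}.

Lemma leS_homo c : (forall i, c i <= c i.+1) -> {homo c : i j / (i <= j)%N >-> i <= j}.
Proof.
move=> cS i j /subnK<-; elim: (j - i)%N => // k IH.
by rewrite addSn; apply: le_trans IH _.
Qed.

(** An inclusion-maximal chain containing [A] is sorted into a list. By maximality it contains every
    element comparable with all its members: the bottom, the top, and anything strictly between two
    consecutive entries. *)
Lemma max_chain_exists (A : {set L}) (x0 : L) : chain_set (mem A) ->
  exists m c, max_chain m c /\ forall x, x \in A -> exists i, x = c i.
Proof.
pose P (B : {set L}) := [forall x in B, forall y in B, x >=< y].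
have PP (B : {set L}) : reflect (chain_set (mem B)) (P B).
  apply: (iffP forallP) => [H x y xB yB|H x].
    by have := H x; rewrite [x \in B]xB => /forallP/(_ y); rewrite [y \in B]yB.
  by apply/implyP => xB; apply/forallP => y; apply/implyP; apply: H.
move=> /PP/maxset_exists[B /maxsetP[/PP chB Bmax] AB].
have addB x : (forall y, y \in B -> x >=< y) -> x \in B.
  move=> xB; rewrite -(Bmax (x |: B)) ?subsetUr ?setU11 //.
  apply/PP => y z; rewrite /= !inE => /predU1P[->|yB] /predU1P[->|zB].
  - exact: comparablexx.
  - exact: xB.
  - by rewrite comparable_sym; apply: xB.
  - exact: chB.
pose s := sort <=%O (enum B).
have memS x : (x \in s) = (x \in B) by rewrite mem_sort mem_enum.
have sS : sorted <=%O s.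
  apply: (@sort_sorted_in _ (mem B)); last by apply/allP => x; rewrite mem_enum.
  by move=> x y xB yB; apply: chB.
have uS : uniq s by rewrite sort_uniq enum_uniq.
have bigle (r : seq L) x y : x \in r -> x <= foldr Order.join y r.
  by elim: r => //= z r IH; rewrite inE => /predU1P[->|/IH];
      rewrite ?leUl // => /le_trans->//; rewrite leUr.
have bigge (r : seq L) x y : x \in r -> foldr Order.meet y r <= x.
  elim: r => //= z r IH; rewrite inE => /predU1P[->|/IH xr]; first by rewrite leIl.
  by apply: le_trans xr; rewrite leIr.
(* Only the element [x0] is given, so the top and bottom of [L] are formed as the join and meet of
   the whole enumeration. *)
pose tp := foldr Order.join x0 (enum L); pose bt := foldr Order.meet x0 (enum L).
have tpP x : x <= tp by apply: bigle; rewrite mem_enum.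
have btP x : bt <= x by apply: bigge; rewrite mem_enum.
have tpS : tp \in s by rewrite memS addB // => y _; rewrite /Order.comparable tpP orbT.
have btS : bt \in s by rewrite memS addB // => y _; rewrite /Order.comparable btP.
have s0 : (0 < size s)%N by case: (s) tpS.
have leN i j : (i <= j)%N -> (j < size s)%N -> nth tp s i <= nth tp s j.
  move=> ij js; apply: (sorted_leq_nth le_trans le_refl) => //; rewrite inE //.
  exact: leq_ltn_trans js.
have ltN i j : (i < j)%N -> (j < size s)%N -> nth tp s i < nth tp s j.
  move=> ij js; rewrite lt_neqAle leN ?(ltnW ij) // andbT nth_uniq // ?neq_ltn ?ij //.
  exact: ltn_trans js.
(* The default value [tp] keeps the sequence at the top beyond the end of the list. *)
exists (size s).-1, (nth tp s); split; last first.
  by move=> x /(subsetP AB); rewrite -memS => xS; exists (index x s); rewrite nth_index.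
split.
- move=> x; apply: le_trans (btP x); rewrite -(nth_index tp btS).
  by apply: leN; rewrite // index_mem.
- move=> x; apply: le_trans (tpP x) _; rewrite -[leLHS](nth_index tp tpS).
  by apply: leN; [rewrite -ltnS prednK ?index_mem | rewrite prednK].
- move=> i; have [is1|] := ltnP i.+1 (size s); first exact: leN.
  by move=> /(nth_default tp)->.
move=> i im; have iS : (i.+1 < size s)%N by rewrite -(prednK s0) ltnS.
apply/coveredP; split; first exact: ltN.
move=> z iz; rewrite le_eqVlt => /predU1P[//|zi].
have zS : z \in s.
  rewrite memS; apply: addB => y; rewrite -memS => /(nthP tp)[j js <-].
  have [ji|ij] := leqP j i.
    by rewrite /Order.comparable (le_trans (leN _ _ ji (ltnW iS)) (ltW iz)) orbT.
  by rewrite /Order.comparable (le_trans (ltW zi) (leN _ _ ij js)).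
have zE := nth_index tp zS; have js : (index z s < size s)%N by rewrite index_mem.
move: iz zi; rewrite -zE; have [ji|ij] := leqP (index z s) i.
  by rewrite le_gtF ?leN ?(ltnW iS).
by move=> _; rewrite le_gtF ?leN.
Qed.

(** By semimodularity [c_i v e_(j+1)] covers or equals [c_i v e_j]. The element [c_(i+1) v e_j] lies
    between the two and differs from the lower one, so it equals the upper one: step [i] of the
    first chain and step [j] of the second are absorbed together. *)
Lemma max_chains_half m n c e : semimodular L -> max_chain m c -> max_chain n e ->
  forall i j, (i < m)%N -> (j < n)%N ->
    c i.+1 <= c i `|` e j.+1 -> ~~ (c i.+1 <= c i `|` e j) ->
    (e j.+1 <= c i.+1 `|` e j) /\ ~~ (e j.+1 <= c i `|` e j).
Proof.
move=> sm mc me i j im jn le1 nle.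
have cov : covered_or_eq (c i `|` e j) (c i `|` e j.+1).
  rewrite !(joinC (c i)); apply: semimodularP sm _ _ _ _.
  by rewrite /covered_or_eq (max_chain_cov me) ?orbT.
have lec := max_chain_leS mc i; have lee := max_chain_leS me j.
have [|||E] := @covered_or_eq_between _ _ (c i.+1 `|` e j) cov.
- by rewrite leU2.
- by rewrite leUx le1 (le_trans lee) ?leUr.
- by move=> E; case/negP: nle; rewrite -E leUl.
split; first by rewrite E leUr.
apply: contra nle => H; apply: le_trans le1 _; rewrite leUx leUl; exact: H.
Qed.

(** This is the Jordan-Hölder matching of the steps of two maximal chains. [f i] is the predecessor
    of the least [j] with [c_(i+1) <= c_i v e_j], and [g] is defined symmetrically;
    [max_chains_half] at [(i, f i)] pins [g (f i)] down to [i]. *)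
Lemma max_chains_perm m n c e : semimodular L -> max_chain m c -> max_chain n e ->
  exists (f : 'I_m -> 'I_n) (g : 'I_n -> 'I_m),
    [/\ cancel f g, cancel g f,
        forall (i : 'I_m) j, (c i.+1 <= c i `|` e j) = (f i < j)%N
      & forall (j : 'I_n) i, (e j.+1 <= c i `|` e j) = (g j < i)%N].
Proof.
have least m' n' c' e' : max_chain m' c' -> max_chain n' e' ->
    exists f : 'I_m' -> 'I_n', forall (i : 'I_m') j, (c' i.+1 <= c' i `|` e' j) = (f i < j)%N.
  move=> mc me; have ex (i : 'I_m') : exists k : 'I_n', forall j, (c' i.+1 <= c' i `|` e' j)
      = (k < j)%N.
    have ex : exists j, c' i.+1 <= c' i `|` e' j.
      by exists n'; apply: le_trans (leUr _ _); apply: max_chain_top me _.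
    case: (ex_minnP ex) => j leij jmin.
    (* At [j = 0] the join is [c_i] itself, as [e_0] is the bottom; hence the predecessor of [j] is
       the number of a step. *)
    have j0 : (0 < j)%N.
      rewrite lt0n; apply: contraL leij => /eqP->.
      have /coveredP[lt _] := max_chain_cov mc (ltn_ord i).
      by rewrite (join_l (max_chain_bot me _)) lt_geF.
    have jn : (j <= n')%N.
      by apply: jmin; apply: le_trans (leUr _ _); apply: max_chain_top me _.
    have kn : (j.-1 < n')%N by rewrite prednK.
    exists (Ordinal kn) => k /=; rewrite prednK //; apply/idP/idP; first exact: jmin.
    move=> jk; apply: le_trans leij _; rewrite leU2 //.
    exact: leS_homo (max_chain_leS me) _ _ jk.
  by have [f fP] := fin_all_exists ex; exists f.
move=> sm mc me; have [f fP] := least _ _ _ _ mc me; have [g gP] := least _ _ _ _ me mc.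
exists f, g; split=> //; last by move=> j i; rewrite joinC.
  move=> i; apply/val_inj/eqP => /=.
  have := max_chains_half sm mc me (ltn_ord i) (ltn_ord (f i)).
  by rewrite !fP ltnSn ltnn => -[] //; rewrite joinC gP ltnS joinC gP -leqNgt eqn_leq => -> ->.
move=> j; apply/val_inj/eqP => /=.
have := max_chains_half sm me mc (ltn_ord j) (ltn_ord (g j)).
by rewrite !gP ltnSn ltnn => -[] //; rewrite joinC fP ltnS joinC fP -leqNgt eqn_leq => -> ->.
Qed.

(** Among the elements below [x] but not below [y] take a minimal one: everything strictly smaller
    is below [y], so it is not a join of smaller elements. *)
Lemma ji_separate x y : ~~ (x <= y) ->
  exists u, [/\ join_irreducible u, u <= x & ~~ (u <= y)].
Proof.
move=> xy; have xA : x \in [set u | (u <= x) && ~~ (u <= y)] by rewrite inE lexx.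
have [u] := exists_minimal xA; rewrite inE => /andP[ux uy] umin.
have small v : v < u -> v <= y.
  move=> vu; apply/negPn/negP => vy; have := umin v.
  by rewrite inE vu vy (le_trans (ltW vu) ux) => /(_ isT).
exists u; split=> //; rewrite /join_irreducible; apply/andP; split.
  by apply: contra uy => /forallP.
apply/existsP => -[v /existsP[w /and3P[/small vy /small wy /eqP uE]]].
by case/negP: uy; rewrite uE leUx vy.
Qed.

End MaximalChains.

(** * Charts *)

Section Charts.
Local Open Scope order_scope.
Context d (L : finLatticeType d) (h : nat).
Implicit Types (x y z : L) (c e : nat -> L) (s t : 'S_h).

(** Only joins and inequalities occur, so that exchanging the chains and transport along an
    isomorphism are immediate. The covering relations and semimodularity are derived from this. *)
Record chart s c e : Prop := Chart {
  chart_bot1 : forall x, c 0%N <= x;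
  chart_bot2 : forall x, e 0%N <= x;
  chart_top1 : forall x, x <= c h;
  chart_top2 : forall x, x <= e h;
  chart_leS1 : forall i, c i <= c i.+1;
  chart_leS2 : forall j, e j <= e j.+1;
  chart_join : forall x, exists i j, x = c i `|` e j;
  chart_perm1 : forall (i : 'I_h) j, (c i.+1 <= c i `|` e j) = (s i < j)%N;
  chart_perm2 : forall (j : 'I_h) i, (e j.+1 <= c i `|` e j) = ((s^-1)%g j < i)%N
}.

Lemma chart_sym s c e : chart s c e -> chart s^-1 e c.
Proof.
case=> ? ? ? ? ? ? cj ? ?; split=> //.
- by move=> x; have [i [j ->]] := cj x; exists j, i; rewrite joinC.
- by move=> i j; rewrite joinC.
by move=> i j; rewrite joinC invgK.
Qed.

Lemma chart_homo1 s c e : chart s c e -> {homo c : i j / (i <= j)%N >-> i <= j}.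
Proof. by move=> ch; apply: leS_homo (chart_leS1 ch). Qed.

Lemma chart_homo2 s c e : chart s c e -> {homo e : i j / (i <= j)%N >-> i <= j}.
Proof. by move=> ch; apply: leS_homo (chart_leS2 ch). Qed.

Definition chart_le_bool s (i k l : nat) : bool :=
  [forall i' : 'I_h, (k <= i' < i) ==> (s i' < l)]%N.

(** Climb from [c_k] to [c_i]: once [c_i'] is below the join, [c_(i'+1)] is below it exactly when it
    is below [c_i' v e_l], which the chart decides by [s i' < l]. Beyond [h] the chain stays at the
    top. *)
Lemma chart_le s c e i k l : chart s c e ->
  (c i <= c k `|` e l) = chart_le_bool s i k l.
Proof.
move=> ch; elim: i => [|i IH].
  rewrite (chart_bot1 ch); apply/esym/forallP => x; apply/implyP; lia.
have [ik|ki] := ltnP i k.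
  rewrite (le_trans (chart_homo1 ch ik)) ?leUl //.
  by apply/esym/forallP => x; apply/implyP; lia.
have -> : (c i.+1 <= c k `|` e l) = (c i <= c k `|` e l) && (c i.+1 <= c i `|` e l).
  apply/idP/andP => [le|[lei leS]]; last by apply: le_trans leS _; rewrite leUx lei leUr.
  split; first exact: le_trans (chart_leS1 ch i) le.
  by apply: le_trans le _; rewrite leU2 // (chart_homo1 ch).
rewrite IH; have [ih|hi] := ltnP i h.
  rewrite (chart_perm1 ch (Ordinal ih)); apply/andP/forallP => [[/forallP H si] x|H].
    apply/implyP; rewrite ltnS => /andP[kx]; rewrite leq_eqVlt => /predU1P[xi|xi].
      by rewrite (_ : x = Ordinal ih) //; apply: val_inj.
    by have := H x; rewrite kx xi.
  split; last by have := H (Ordinal ih); rewrite /= ki ltnSn.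
  by apply/forallP => x; have := H x; case: (k <= x)%N => //= /implyP H';
      apply/implyP => /ltnW/H'.
have -> : c i.+1 <= c i `|` e l.
  by apply: le_trans (chart_top1 ch _) _; apply: le_trans (chart_homo1 ch hi) _; rewrite leUl.
rewrite andbT; apply/eq_forallb => x.
by rewrite (leq_trans (ltn_ord x) hi) (leq_trans (ltn_ord x)) // (leq_trans hi).
Qed.

Lemma chart_le2 s c e j k l : chart s c e ->
  (e j <= c k `|` e l) = chart_le_bool s^-1 j l k.
Proof. by move/chart_sym/chart_le<-; rewrite joinC. Qed.

Lemma chart_joinU s c e i j k l : chart s c e ->
  (c i `|` e j) `|` (c k `|` e l) = c (maxn i k) `|` e (maxn j l).
Proof.
move=> ch; rewrite joinACA; congr (_ `|` _).
  have [ik|ki] := leqP i k; first by rewrite (join_r (chart_homo1 ch ik)).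
  by rewrite (join_l (chart_homo1 ch (ltnW ki))).
have [ik|ki] := leqP j l; first by rewrite (join_r (chart_homo2 ch ik)).
by rewrite (join_l (chart_homo2 ch (ltnW ki))).
Qed.

Lemma chart_above s c e i j w : chart s c e -> c i `|` e j <= w ->
  exists k l, [/\ (i <= k)%N, (j <= l)%N & w = c k `|` e l].
Proof.
move=> ch; have [k [l ->]] := chart_join ch w => le.
exists (maxn i k), (maxn j l); rewrite !leq_maxl; split=> //.
by rewrite -(chart_joinU _ _ _ _ ch) (join_r le).
Qed.

(** Let [w] lie strictly above the left side and below the right one. If [w] has a representation
    with first index above [i], it is the right side. Otherwise [w = c_i v e_b], where [e_b] is
    below [c_(i+1) v e_l] but not below [c_i v e_l]; this forces [s i < b], and so
    [c_(i+1) <= w]. *)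
Lemma chart_step s c e i l : chart s c e ->
  covered_or_eq (c i `|` e l) (c i.+1 `|` e l).
Proof.
move=> ch; rewrite /covered_or_eq.
have le : c i `|` e l <= c i.+1 `|` e l by rewrite leU2 // (chart_leS1 ch).
case: eqVneq => //= ne; apply/coveredP; rewrite lt_neqAle ne le; split=> // w.
move=> lw wr; apply/le_anti; rewrite wr /=.
have [k [b [ik lb wE]]] := chart_above ch (ltW lw).
move: ik; rewrite leq_eqVlt => /predU1P[ik|ik]; last first.
  by rewrite wE leU2 // ?(chart_homo1 ch) ?(chart_homo2 ch).
have elw : e l <= w by rewrite wE; apply: le_trans (chart_homo2 ch lb) _; rewrite leUr.
rewrite leUx elw andbT.
have eb1 : e b <= c i.+1 `|` e l by apply: le_trans wr; rewrite wE leUr.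
have : ~~ (e b <= c i `|` e l).
  apply: contraL lw => eb; rewrite le_gtF // wE -ik leUx leUl eb //.
move: eb1; rewrite !(chart_le2 _ _ _ ch) => /forallP H /forallPn[j].
rewrite negb_imply => /andP[ljb]; rewrite -leqNgt => isj; have := H j;
    rewrite ljb /= ltnS => sji.
have iE : i = (s^-1)%g j by apply/eqP; rewrite eqn_leq isj sji.
by rewrite wE -ik iE (chart_perm1 ch) permKV; case/andP: ljb.
Qed.

Lemma chart_max_chain s c e : chart s c e -> max_chain h c.
Proof.
move=> ch; split; [exact: chart_bot1 ch|exact: chart_top1 ch|exact: chart_leS1 ch|].
move=> i ih; have := chart_step i 0 ch.
have jE x : x `|` e 0%N = x by apply: join_l; apply: chart_bot2 ch _.
rewrite !jE => /predU1P[E|//].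
by have := chart_perm1 ch (Ordinal ih) 0; rewrite /= jE -E lexx ltn0.
Qed.

Lemma chart_slim s c e : chart s c e -> slim L.
Proof.
move=> ch; apply/existsP => -[x /existsP[y /existsP[z]]].
have half u : join_irreducible u -> (exists i, u = c i) \/ (exists j, u = e j).
  have [i [j uE]] := chart_join ch u => /andP[_ /existsPn/(_ (c i))/existsPn/(_ (e j))].
  rewrite uE eqxx andbT !lt_neqAle leUl leUr !andbT negb_and !negbK.
  by case/orP => /eqP <-; [left; exists i|right; exists j].
have chc i k : c i >=< c k.
  by rewrite /Order.comparable; case/orP: (leq_total i k) => /(chart_homo1 ch)->;
      rewrite ?orbT.
have che i k : e i >=< e k.
  by rewrite /Order.comparable; case/orP: (leq_total i k) => /(chart_homo2 ch)->;
      rewrite ?orbT.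
case/and5P=> /half[] [i ->] /half[] [j ->] /half[] [k ->]; rewrite ?chc ?che ?andbF //.
Qed.

Lemma chain_crossing c k x : (forall x, c 0%N <= x) -> ~~ (c k <= x) ->
  exists2 i, (i < k)%N & (c i <= x) && ~~ (c i.+1 <= x).
Proof.
move=> bot; elim: k => [|k IH]; first by rewrite bot.
have [ck cSk|/IH[i ik H] _] := boolP (c k <= x); first by exists k; rewrite ?ck.
by exists i; rewrite // ltnW.
Qed.

(** The chain leaves the ideal of [x] at some step [i] that still ends below [y], so
    [y = x v c_(i+1)]. Joining [z] then amounts to joining [c_(i+1)] to an element above [c_i],
    which is either [chart_step] or trivial. *)
Lemma chart_semimodular_half s c e k x y z : chart s c e -> covered_by x y ->
  c k <= y -> ~~ (c k <= x) -> covered_or_eq (x `|` z) (y `|` z).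
Proof.
move=> ch /coveredP[xy cov] cky /(chain_crossing (chart_bot1 ch))[i ik /andP[cix ciNx]].
have ciy : c i.+1 <= y by apply: le_trans cky; apply: chart_homo1 ch _ _ _.
have yE : y = x `|` c i.+1.
  apply/esym/cov; last by rewrite leUx ltW.
  by rewrite lt_neqAle leUl andbT; apply: contraNneq ciNx => ->; rewrite leUr.
have [|a [b [ia _ wE]]] := @chart_above s c e i 0 (x `|` z) ch.
  by rewrite (join_l (chart_bot2 ch _)) (le_trans cix) ?leUl.
have -> : y `|` z = (x `|` z) `|` c i.+1 by rewrite yE joinAC.
move: ia; rewrite leq_eqVlt => /predU1P[ia|ia].
  rewrite wE -ia joinAC (join_r (chart_leS1 ch i)); exact: chart_step ch.
have le : c i.+1 <= x `|` z.
  by rewrite wE; apply: le_trans (leUl _ _); apply: chart_homo1 ch _ _ ia.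
by rewrite (join_l le) /covered_or_eq eqxx.
Qed.

Lemma chart_covered_above s c e i w : chart s c e -> (i < h)%N ->
  covered_by (c i) w -> w = c i.+1 \/ exists2 j, w = c i `|` e j & ~~ (e j <= c i).
Proof.
move=> ch ih /coveredP[iw cov].
have [|a [b [ia _ wE]]] := @chart_above s c e i 0 w ch.
  by rewrite (join_l (chart_bot2 ch _)) ltW.
have /coveredP[cc _] := max_chain_cov (chart_max_chain ch) ih.
move: ia; rewrite leq_eqVlt => /predU1P[ia|ia]; last first.
  left; apply/esym/cov => //; rewrite wE; apply: le_trans (leUl _ _).
  exact: chart_homo1 ch _ _ ia.
right; exists b; first by rewrite wE ia.
by apply: contraL iw => eb; rewrite wE -ia (join_l eb) ltxx.
Qed.

End Charts.

Section ChartLattices.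
Local Open Scope order_scope.

Lemma chart_semimodular d (L : finLatticeType d) h (s : 'S_h) c e :
  @chart d L h s c e -> semimodular L.
Proof.
move=> ch; apply/forallP => x; apply/forallP => y; apply/forallP => z; apply/implyP.
case/predU1P=> [->|cov]; first by rewrite /covered_or_eq eqxx.
have [k [l yE]] := chart_join ch y.
have cky : c k <= y by rewrite yE leUl.
have ely : e l <= y by rewrite yE leUr.
have [ckx|ckx] := boolP (c k <= x); last exact: chart_semimodular_half ch cov cky ckx.
have [elx|elx] := boolP (e l <= x).
  by case/coveredP: cov => /lt_geF; rewrite yE leUx ckx elx.
exact: chart_semimodular_half (chart_sym ch) cov ely elx.
Qed.

Lemma order_iso_isomorphic d d' (L : finLatticeType d) (M : finLatticeType d') (f : L -> M) :
  (forall x y, (f x <= f y) = (x <= y)) -> (forall y, exists x, y = f x) -> isomorphic L M.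
Proof.
move=> fle fsurj; apply/existsP; exists [ffun x => f x]; apply/and3P; split.
- by apply/injectiveP => x y; rewrite !ffunE => E; apply/le_anti; rewrite -!fle E lexx.
- by apply/forallP => y; have [x ->] := fsurj y; apply/codomP; exists x; rewrite ffunE.
apply/forallP => x; apply/forallP => y; rewrite !ffunE; apply/andP; split; apply/eqP/le_anti.
  rewrite lexI !fle leIl leIr /=; have [w wE] := fsurj (f x `&` f y).
  by rewrite wE fle lexI -!fle -wE leIl leIr.
rewrite leUx !fle leUl leUr andbT /=; have [w wE] := fsurj (f x `|` f y).
by rewrite wE fle leUx -!fle -wE leUl leUr.
Qed.

Lemma isomorphicP d d' (L : finLatticeType d) (M : finLatticeType d') :
  isomorphic L M -> exists (f : L -> M),
   [/\ (forall x y, (f x <= f y) = (x <= y)), (forall y, exists x, y = f x)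
     & forall x y, f (x `|` y) = f x `|` f y].
Proof.
case/existsP=> f /and3P[/injectiveP inj /forallP surj /forallP hom]; exists f.
have fI x y : f (x `&` y) = f x `&` f y by have /forallP/(_ y)/andP[/eqP] := hom x.
have fU x y : f (x `|` y) = f x `|` f y by have /forallP/(_ y)/andP[_ /eqP] := hom x.
split=> [x y|y|//]; last by have /codomP := surj y.
by rewrite !leEmeet -fI (inj_eq inj).
Qed.

Lemma chart_transport d d' (L : finLatticeType d) (M : finLatticeType d') h (s : 'S_h) c e :
  isomorphic L M -> @chart d L h s c e -> exists c' e', @chart d' M h s c' e'.
Proof.
move=> /isomorphicP[f [fle fsurj fU]] ch; exists (f \o c), (f \o e); split=> /=.
- by move=> y; have [x ->] := fsurj y; rewrite fle (chart_bot1 ch).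
- by move=> y; have [x ->] := fsurj y; rewrite fle (chart_bot2 ch).
- by move=> y; have [x ->] := fsurj y; rewrite fle (chart_top1 ch).
- by move=> y; have [x ->] := fsurj y; rewrite fle (chart_top2 ch).
- by move=> i; rewrite fle (chart_leS1 ch).
- by move=> i; rewrite fle (chart_leS2 ch).
- by move=> y; have [x ->] := fsurj y; have [i [j ->]] := chart_join ch x; exists i, j;
    rewrite fU.
- by move=> i j; rewrite -fU fle (chart_perm1 ch).
- by move=> i j; rewrite -fU fle (chart_perm2 ch).
Qed.

Lemma chart_isomorphic d d' (L : finLatticeType d) (M : finLatticeType d') h (s : 'S_h)
    c e c' e' :
  @chart d L h s c e -> @chart d' M h s c' e' -> isomorphic L M.
Proof.
move=> ch ch'.
have rep x : exists u : nat * nat, x == c u.1 `|` e u.2.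
  by have [i [j ->]] := chart_join ch x; exists (i, j).
have le4 i j k l : (c' i `|` e' j <= c' k `|` e' l) = (c i `|` e j <= c k `|` e l).
  by rewrite !leUx !(chart_le _ _ _ ch) !(chart_le _ _ _ ch') !(chart_le2 _ _ _ ch)
      !(chart_le2 _ _ _ ch').
pose r x := xchoose (rep x); have rE x : x = c (r x).1 `|` e (r x).2.
  by apply/eqP; apply: xchooseP (rep x).
apply: (@order_iso_isomorphic _ _ _ _ (fun x => c' (r x).1 `|` e' (r x).2)) => [x y|y].
  by rewrite le4 -!rE.
have [i [j ->]] := chart_join ch' y; exists (c i `|` e j).
by apply/le_anti; rewrite !le4 -!rE !lexx.
Qed.

(** Extending the two chains of join-irreducibles to maximal chains makes the matching of steps
    available. If [c_i] and [e_j] are the largest members of the chains below [x], every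
    join-irreducible below [x] is under one of them, and [ji_separate] yields [x = c_i v e_j]. *)
Lemma chart_exists d (L : finLatticeType d) (x0 : L) : slim L -> semimodular L ->
  exists h (s : 'S_h) c e, @chart d L h s c e.
Proof.
move=> /existsPn sl sm.
have [|A [B [JE chA chB]]] := @dilworth2 _ L [set x | join_irreducible x].
  move=> x y z; rewrite !inE => xJ yJ zJ.
  by have /existsPn/(_ y)/existsPn/(_ z) := sl x; rewrite xJ yJ zJ.
have [m [c [mc Ac]]] := max_chain_exists x0 chA.
have [n [e [me Be]]] := max_chain_exists x0 chB.
have [f [g [fK gK fP gP]]] := max_chains_perm sm mc me.
have mn : m = n by rewrite -(card_ord m) -(card_ord n); apply: bij_eq_card; exists g; eauto.
subst n; exists m, (perm (can_inj fK)), c, e.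
case: (mc) (me) => [cbot ctop cS _] [ebot etop eS _]; split=> //.
- move=> x.
  have ub (c1 : nat -> L) : max_chain m c1 -> exists i, c1 i <= x /\ forall k, c1 k <= x ->
      c1 k <= c1 i.
    move=> mc1; case: (@arg_maxnP 'I_m.+1 ord0 (fun i => c1 i <= x) val).
      exact: max_chain_bot mc1 _.
    move=> i ix imax; exists i; split=> // k kx.
    have [km|mk] := ltnP k m.+1.
      by apply: leS_homo (max_chain_leS mc1) _ _ _; apply: (imax (Ordinal km)).
    have mx : c1 m <= x by apply: le_trans kx; apply: leS_homo (max_chain_leS mc1) _ _ (ltnW
        mk).
    apply: le_trans (max_chain_top mc1 _) _.
    apply: leS_homo (max_chain_leS mc1) _ _ _; exact: (imax ord_max).
  have [i [ix imax]] := ub _ mc; have [j [jx jmax]] := ub _ me.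
  exists i, j; apply/le_anti; rewrite leUx ix jx !andbT.
  apply/negPn/negP => /ji_separate[u [uJ ux /negP[]]].
  have : u \in A :|: B by rewrite -JE inE.
  rewrite inE => /orP[/Ac|/Be] [k uE]; rewrite uE in ux *.
    by apply: le_trans (imax _ ux) (leUl _ _).
  by apply: le_trans (jmax _ ux) (leUr _ _).
- by move=> i j; rewrite fP permE.
move=> j i; rewrite gP; congr (val _ < _)%N.
by apply: (@perm_inj _ (perm (can_inj fK))); rewrite permKV permE gK.
Qed.

Lemma chart_length d (L : finLatticeType d) h h' (s : 'S_h) (s' : 'S_h') c e c' e' :
  @chart d L h s c e -> @chart d L h' s' c' e' -> h = h'.
Proof.
move=> ch ch'; have sm := chart_semimodular ch.
have [f [g [fK gK _ _]]] := max_chains_perm sm (chart_max_chain ch) (chart_max_chain ch').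
by rewrite -(card_ord h) -(card_ord h'); apply: bij_eq_card; exists g; eauto.
Qed.

End ChartLattices.

(** * Uniqueness of charts *)

Section ChartUniqueness.
Local Open Scope order_scope.
Context d (L : finLatticeType d) (h : nat).
Implicit Types (x y z : L) (c e : nat -> L) (s t : 'S_h).

Lemma chart_ltS s c e i : @chart d L h s c e -> (i < h)%N -> ~~ (c i.+1 <= c i).
Proof.
by move=> ch ih; have := chart_perm1 ch (Ordinal ih) 0; rewrite (join_l (chart_bot2 ch _)) =>
    ->.
Qed.

Lemma chart_le_cut s c e m : @chart d L h s c e -> (c m <= e m) = cut s m.
Proof.
move=> ch; have := chart_le m 0 m ch; rewrite (join_r (chart_bot1 ch _)) => ->.
by apply/forallP/cutP => H x; have := H x; rewrite ?(implyTb) //= => /implyP.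
Qed.

Lemma chart_ge_cut s c e m : @chart d L h s c e -> (e m <= c m) = cut s m.
Proof. by move/chart_sym/chart_le_cut->; rewrite cutV. Qed.

Lemma chart_cut s c e m : @chart d L h s c e -> (c m == e m) = cut s m.
Proof. by move=> ch; rewrite eq_le (chart_le_cut _ ch) (chart_ge_cut _ ch) andbb. Qed.

Lemma chart_cover1 s c e i : @chart d L h s c e -> (i < h)%N -> covered_by (c i) (c i.+1).
Proof. by move=> ch; exact: (max_chain_cov (chart_max_chain ch)). Qed.

Lemma chart_cover2 s c e i : @chart d L h s c e -> (i < h)%N -> covered_by (e i) (e i.+1).
Proof. by move=> ch; exact: (max_chain_cov (chart_max_chain (chart_sym ch))). Qed.

Lemma chart_cover_cases s c e i j w : @chart d L h s c e -> (i < h)%N ->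
  (forall j', (j' < j)%N -> e j' <= c i) -> ~~ (e j <= c i) ->
  covered_by (c i) w -> w = c i.+1 \/ w = c i `|` e j.
Proof.
move=> ch ih ejs ej cov; have [->|[k wE ek]] := chart_covered_above ch ih cov; first by left.
right; case/coveredP: cov => _ /(_ (c i `|` e j)) <- //.
  by rewrite lt_neqAle leUl andbT; apply: contraNneq ej => ->; rewrite leUr.
rewrite wE leU2 // (chart_homo2 ch) // leqNgt; apply: contra ek; exact: ejs.
Qed.

(* The covers of [c_i] are [c_(i+1)] and [c_i v e_j], where [e_j] is the least
   element of the second chain not below [c_i]; between two cuts [j <= i], so
   [c_(i+1)] is determined by what lies lower. *)
Lemma chart_next s s' c e c' e' u i :
  @chart d L h s c e -> @chart d L h s' c' e' -> (u <= i < h)%N ->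
  c u = e u -> c i != e i ->
  (forall k, (u <= k <= i)%N -> c' k = c k /\ e' k = e k) ->
  c' i.+1 = c i.+1.
Proof.
move=> ch ch' /andP[ui ih] cu ci E; have [ciE _] : c' i = c i /\ e' i = e i by apply: E; lia.
have ei : ~~ (e i <= c i).
  by rewrite (chart_ge_cut _ ch) -(chart_cut _ ch).
have ex : exists j, ~~ (e j <= c i) by exists i.
case: (ex_minnP ex) => j ej jmin; have ji : (j <= i)%N := jmin i ei.
have small j' : (j' < j)%N -> e j' <= c i.
  by move=> lt; apply/negPn/negP => /jmin; rewrite leqNgt lt.
have uj : (u < j)%N.
  rewrite ltnNge; apply: contra ej => ju; apply: le_trans (chart_homo2 ch ju) _.
  by rewrite -cu (chart_homo1 ch).
have [_ ejE] : c' j = c j /\ e' j = e j by apply: E; rewrite (ltnW uj).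
have small' j' : (j' < j)%N -> e' j' <= c' i.
  move=> lt; have [uj'|/ltnW j'u] := leqP u j'.
    have [_ ->] : c' j' = c j' /\ e' j' = e j' by apply: E; lia.
    by rewrite ciE small.
  apply: le_trans (chart_homo2 ch' j'u) _.
  have [_ ->] : c' u = c u /\ e' u = e u by apply: E; rewrite leqnn.
  by rewrite ciE -cu (chart_homo1 ch).
have ej' : ~~ (e' j <= c' i) by rewrite ciE ejE.
have cov := chart_cover1 ch ih; have cov' := chart_cover1 ch' ih.
rewrite -ciE in cov; rewrite ciE in cov'.
(* If [c'_(i+1)] differs from [c_(i+1)], it is [c_i v e_j]; by symmetry [c_(i+1)] is [c'_i v e'_j],
   which is the same element. *)
have [//|E1] := chart_cover_cases ch ih small ej cov'.
have [->//|E2] := chart_cover_cases ch' ih small' ej' cov.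
by rewrite E2 E1 ciE ejE.
Qed.

(** [chart_next] applies to levels where the two chains are apart. At [u] they meet, which is why
    agreement at [u.+1] is assumed: it fixes the orientation. *)
Lemma chart_segment s s' c e c' e' u v :
  @chart d L h s c e -> @chart d L h s' c' e' -> (v <= h)%N ->
  c u = e u -> c' u = c u -> e' u = e u -> c' u.+1 = c u.+1 -> e' u.+1 = e u.+1 ->
  (forall m, (u < m < v)%N -> ~~ cut s m) ->
  forall m, (u <= m <= v)%N -> c' m = c m /\ e' m = e m.
Proof.
move=> ch ch' vh cu c'u e'u c'u1 e'u1 nocut m.
elim/ltn_ind: m => -[|m] IH /andP[um mv]; first by move: um; rewrite leqn0 => /eqP<-.
move: um; rewrite leq_eqVlt => /predU1P[<-//|]; rewrite ltnS => um.
have [->//|mu] := eqVneq m u.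
have ne : c m != e m by rewrite (chart_cut _ ch) nocut //; lia.
have IH' k : (u <= k <= m)%N -> c' k = c k /\ e' k = e k by move=> /andP[uk km]; apply: IH;
    lia.
have umh : (u <= m < h)%N by lia.
split; first exact: chart_next ch ch' umh cu ne IH'.
apply: chart_next (chart_sym ch) (chart_sym ch') umh (esym cu) _ _; first by rewrite eq_sym.
by move=> k /IH'[].
Qed.

(** Where the chains meet, every member of a chain that covers the meeting point is the next element
    of [c] or of [e]. If [c'] and [e'] both continue with the same one, the remaining element is in
    turn a next element of [c'] or [e'], so all of them coincide. *)
Lemma chart_orientation s s' c e c' e' u :
  @chart d L h s c e -> @chart d L h s' c' e' -> (u < h)%N ->
  c u = e u -> c' u = c u -> e' u = e u ->
  (c' u.+1 = c u.+1 /\ e' u.+1 = e u.+1) \/ (c' u.+1 = e u.+1 /\ e' u.+1 = c u.+1).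
Proof.
move=> ch ch' uh cu c'u e'u.
have two t k f w : @chart d L h t k f -> k u = f u -> covered_by (k u) w ->
    w = k u.+1 \/ w = f u.+1.
  move=> chk ku cov.
  have -> : f u.+1 = k u `|` f u.+1.
    by rewrite join_r // ku; apply: chart_leS2 chk _.
  apply: (chart_cover_cases chk uh) cov => [j|]; last first.
    by rewrite ku; apply: chart_ltS (chart_sym chk) uh.
  by rewrite ltnS ku; apply: chart_homo2 chk _ _.
have c'e'u : c' u = e' u by rewrite c'u e'u.
have covc' := chart_cover1 ch' uh; have cove' := chart_cover2 ch' uh.
have covc := chart_cover1 ch uh; have cove := chart_cover2 ch uh.
rewrite c'u in covc'; rewrite e'u -cu in cove'; rewrite -cu -c'u in cove; rewrite -c'u in covc.
have [E1|E1] := two _ _ _ _ ch cu covc'; have [E2|E2] := two _ _ _ _ ch cu cove'.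
- have [E3|E3] := two _ _ _ _ ch' c'e'u cove; first by left; rewrite E1 E2 E3 E1.
  by left; rewrite E1 E3.
- by left.
- by right.
- have [E3|E3] := two _ _ _ _ ch' c'e'u covc; first by right; rewrite E1 E2 E3 E1.
  by right; rewrite E1 E2 E3 E2.
Qed.

(** Both permutations keep the segment, so [s i] is determined by the comparisons [s i < j] with [j]
    from [u] to [v], and these are inequalities among chain elements at the levels where the charts
    agree. *)
Lemma chart_segment_perm s s' c e c' e' u v :
  @chart d L h s c e -> @chart d L h s' c' e' -> cut s u -> cut s v ->
  (forall m, (u <= m <= v)%N -> c' m = c m /\ e' m = e m) ->
  forall i : 'I_h, (u <= i < v)%N -> s' i = s i.
Proof.
move=> ch ch' su sv E i /andP[ui iv].
have uv := leq_ltn_trans ui iv.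
have cut' m : (u <= m <= v)%N -> cut s' m = cut s m.
  by move=> /E[c'm e'm]; rewrite -(chart_cut _ ch) -(chart_cut _ ch') c'm e'm.
have s'u : cut s' u by rewrite cut' // leqnn ltnW.
have s'v : cut s' v by rewrite cut' // leqnn ltnW.
have lt j : (u <= j <= v)%N -> (s' i < j)%N = (s i < j)%N.
  move=> uj; have [_ e'j] := E j uj.
  have [c'i _] : c' i = c i /\ e' i = e i by apply: E; lia.
  have [c'i1 _] : c' i.+1 = c i.+1 /\ e' i.+1 = e i.+1 by apply: E; lia.
  by rewrite -(chart_perm1 ch) -(chart_perm1 ch') e'j c'i c'i1.
have := cut_ltE i su; have := cut_ltE i sv; have := cut_ltE i s'u; have := cut_ltE i s'v.
rewrite iv !ltnNge ui /= -!ltnNge => s'iv s'iu siv siu.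
apply/val_inj/eqP; rewrite /= eqn_leq -ltnS lt; last by lia.
by rewrite ltnSn /= -ltnS -lt ?ltnSn //; lia.
Qed.

(** Induction from the last earlier cut: up to [m] the second chart follows the first one, possibly
    with the chains exchanged, and the exchange is invisible where [c_m = e_m]. *)
Lemma chart_fixed_cut s s' c e c' e' m :
  @chart d L h s c e -> @chart d L h s' c' e' -> (m <= h)%N -> c m = e m ->
  c' m = c m /\ e' m = e m.
Proof.
move=> ch ch'; elim/ltn_ind: m => m IH mh cm.
case: (posnP m) => [->|m0].
  split; apply/le_anti; first by rewrite (chart_bot1 ch) (chart_bot1 ch').
  by rewrite (chart_bot2 ch) (chart_bot2 ch').
have [u [um cu nocut]] : exists u, [/\ (u < m)%N, c u = e u
     & forall k, (u < k < m)%N -> ~~ cut s k].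
  case: (@arg_maxnP 'I_m (Ordinal m0) (fun u => cut s u) val); first exact: cut0.
  move=> u su umax; exists u; split=> //; first by apply/eqP; rewrite (chart_cut _ ch).
  move=> k /andP[uk km]; apply/negP => sk.
  by have := umax (Ordinal km) sk; rewrite /= leqNgt uk.
have [c'u e'u] := IH u um (ltnW (leq_trans um mh)) cu.
have uh := leq_trans um mh.
have umm : (u <= m <= m)%N by rewrite leqnn ltnW.
have [[c1 e1]|[c1 e1]] := chart_orientation ch ch' uh cu c'u e'u.
  exact: chart_segment ch ch' mh cu c'u e'u c1 e1 nocut m umm.
have [|||c'm e'm] := chart_segment (chart_sym ch) ch' mh (esym cu) _ _ c1 e1 _ umm.
- by rewrite c'u cu.
- by rewrite e'u cu.
- by move=> k /nocut; rewrite cutV.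
by rewrite c'm e'm cm.
Qed.

Lemma chart_sim s s' c e c' e' :
  @chart d L h s c e -> @chart d L h s' c' e' -> sim s s'.
Proof.
move=> ch ch'.
(* Whether the chains are exchanged on the segment containing position [m]. At a cut they coincide,
   so the comparison is made one level higher. *)
pose F m := if c m == e m then c' m.+1 != c m.+1 else c' m != c m.
have seg m : (m < h)%N -> exists u v, [/\ (u <= m < v)%N, (v <= h)%N, c u = e u, cut s v &
    forall k, (u < k < v)%N -> ~~ cut s k].
  move=> mh; have [v [/andP[mv vh] sv nocut]] := next_cut s mh.
  case: (@arg_maxnP 'I_m.+1 ord0 (fun u => cut s u) val); first exact: cut0.
  move=> u su umax; exists u, v; split=> //; first by rewrite -ltnS ltn_ord.
    by apply/eqP; rewrite (chart_cut _ ch).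
  move=> k /andP[uk kv]; have [mk|km] := ltnP m k; first by apply: nocut; rewrite mk.
  apply/negP => sk; rewrite -ltnS in km.
  by have := umax (Ordinal km) sk; rewrite /= leqNgt uk.
have main u v : (u < v <= h)%N -> c u = e u -> cut s v ->
    (forall k, (u < k < v)%N -> ~~ cut s k) ->
    (forall k, (u <= k < v)%N -> F k = (c' u.+1 != c u.+1)) /\
    forall i : 'I_h, (u <= i < v)%N -> s' i = if c' u.+1 != c u.+1 then (s^-1)%g i else s i.
  move=> /andP[uv vh] cu sv nocut; have uh := leq_trans uv vh.
  have [c'u e'u] := chart_fixed_cut ch ch' (ltnW uh) cu.
  have su : cut s u by rewrite -(chart_cut _ ch) cu.
  have ne k : (u < k < v)%N -> c k == e k = false.
    by move=> /nocut; rewrite -(chart_cut _ ch) => /negbTE.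
  have [[c1 e1]|[c1 e1]] := chart_orientation ch ch' uh cu c'u e'u.
    have E := chart_segment ch ch' vh cu c'u e'u c1 e1 nocut.
    rewrite c1 eqxx; split; last by apply: chart_segment_perm ch ch' su sv E.
    move=> k /andP[]; rewrite leq_eqVlt => /predU1P[<- _|uk kv].
      by rewrite /F cu eqxx c1 eqxx.
    by rewrite /F ne ?uk //; have [-> _] : c' k = c k /\ e' k = e k; [apply: E;
        lia|rewrite eqxx].
  (* In the first case [c] and [e] agree at [u.+1] too; the orientation is then ambiguous and counts
     as not exchanged. *)
  have [c11|ne1] := eqVneq (c' u.+1) (c u.+1).
    have e11 : e' u.+1 = e u.+1 by rewrite e1 -c11.
    have E := chart_segment ch ch' vh cu c'u e'u c11 e11 nocut.
    split; last by apply: chart_segment_perm ch ch' su sv E.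
    move=> k /andP[]; rewrite leq_eqVlt => /predU1P[<- _|uk kv].
      by rewrite /F cu eqxx c11 eqxx.
    by rewrite /F ne ?uk //; have [-> _] : c' k = c k /\ e' k = e k; [apply: E;
        lia|rewrite eqxx].
  have nocutV k : (u < k < v)%N -> ~~ cut s^-1 k by move=> /nocut; rewrite cutV.
  have c'eu : c' u = e u by rewrite c'u.
  have e'cu : e' u = c u by rewrite e'u.
  have E := chart_segment (chart_sym ch) ch' vh (esym cu) c'eu e'cu c1 e1 nocutV.
  split; last by apply: chart_segment_perm (chart_sym ch) ch' _ _ E; rewrite cutV.
  move=> k /andP[]; rewrite leq_eqVlt => /predU1P[<- _|uk kv].
    by rewrite /F cu eqxx.
  have [c'k _] : c' k = e k /\ e' k = c k by apply: E; lia.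
  by rewrite /F ne ?uk // c'k eq_sym ne ?uk.
exists F; split=> [m sm|i].
  have mh : (m.+1 < h)%N by rewrite ltnNge; apply: contra sm; apply: cut_ge.
  have [u [v [/andP[um mv] vh cu sv nocut]]] := seg m (ltnW mh).
  have uv := leq_ltn_trans um mv.
  have uvh : (u < v <= h)%N by rewrite uv.
  have mv1 : (m.+1 < v)%N by rewrite ltn_neqAle mv andbT; apply: contraNneq sm => ->.
  have [FE _] := main u v uvh cu sv nocut.
  by rewrite !FE ?um ?mv //= mv1 (leqW um).
have [u [v [/andP[ui iv] vh cu sv nocut]]] := seg i (ltn_ord i).
have uvh : (u < v <= h)%N by rewrite (leq_ltn_trans ui iv).
by have [FE s'E] := main u v uvh cu sv nocut; rewrite s'E ?FE ?ui.
Qed.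

Lemma chart_cut_eq s c e m : @chart d L h s c e -> cut s m -> c m = e m.
Proof. by move=> ch; rewrite -(chart_cut _ ch) => /eqP. Qed.

Definition flip_chain (F : nat -> bool) c e (m : nat) : L := if F m then e m else c m.

(** A step never changes chains: either [F] keeps its value from [m] to [m.+1], or [m.+1] is a cut
    and the chains coincide there. *)
Lemma flip_chainS s c e F m : @chart d L h s c e -> cut_constant s F ->
  flip_chain F c e m.+1 = if F m then e m.+1 else c m.+1.
Proof.
move=> ch Fs; rewrite /flip_chain; have [/(chart_cut_eq ch)->|/Fs->//] := boolP (cut s m.+1).
by case: (F _); case: (F _).
Qed.

Lemma flip_chain_leS s c e F m : @chart d L h s c e -> cut_constant s F ->
  flip_chain F c e m <= flip_chain F c e m.+1.
Proof.
move=> ch Fs; rewrite (flip_chainS _ ch Fs) /flip_chain.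
by case: (F m); [apply: chart_leS2 ch _|apply: chart_leS1 ch _].
Qed.

Lemma flipsVV F s t : flips F s t -> flips F s^-1 t^-1.
Proof.
move=> Fst; split=> [m|x]; first by rewrite cutV; apply: (proj1 Fst).
by rewrite (flipsV x Fst) invgK.
Qed.

(** If [F] agrees at [i] and [j], this is an inequality of the chart or of the chart with exchanged
    chains. Otherwise a cut lies between [i] and [j]; the chains meet there and [t] respects it, so
    both sides only depend on which of [i] and [j] is smaller. *)
Lemma flip_chart_perm s t c e F : @chart d L h s c e -> flips F s t ->
  forall (i : 'I_h) j,
  (flip_chain F c e i.+1 <= flip_chain F c e i `|` flip_chain F e c j) = (t i < j)%N.
Proof.
move=> ch Fst i j; have Fs := proj1 Fst; have FsV := proj1 (flipsVV Fst).
have chV := chart_sym ch.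
have flipC m : cut s m -> flip_chain F c e m = flip_chain F e c m.
  by move=> /(chart_cut_eq ch) E; rewrite /flip_chain E.
have homo1 := leS_homo (fun m => flip_chain_leS m ch Fs).
have homo2 := leS_homo (fun m => flip_chain_leS m chV FsV).
have [Fij|Fij] := eqVneq (F i) (F j).
  rewrite (flip_chainS _ ch Fs) /flip_chain -Fij (proj2 Fst).
  by case: (F i); rewrite ?(chart_perm1 ch) // joinC (chart_perm2 ch).
have [ij|ji] := leqP i j.
  have [m [/andP[im mj] sm]] := cut_constantP Fs Fij ij.
  have tm : cut t m by rewrite (flips_cut _ Fst).
  rewrite (leq_trans _ mj) ?cut_ltE //.
  by rewrite (le_trans (homo1 _ _ im)) // flipC // (le_trans (homo2 _ _ mj)) ?leUr.
rewrite eq_sym in Fij; have [m [/andP[jm mi] sm]] := cut_constantP Fs Fij (ltnW ji).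
have tm : cut t m by rewrite (flips_cut _ Fst).
have := cut_ltE i tm; rewrite [RHS]ltnNge mi /= => /negbT; rewrite -leqNgt => mt.
rewrite [RHS]ltnNge (leq_trans (ltnW jm) mt) /= join_l; last first.
  by rewrite (le_trans (homo2 _ _ (ltnW jm))) // -flipC // homo1.
rewrite (flip_chainS _ ch Fs) /flip_chain; apply/negbTE.
by case: (F i); [apply: chart_ltS chV _|apply: chart_ltS ch _].
Qed.

Lemma chart_flips s t c e F : @chart d L h s c e -> flips F s t ->
  @chart d L h t (flip_chain F c e) (flip_chain F e c).
Proof.
move=> ch Fst; have Fs := proj1 Fst; have FsV := proj1 (flipsVV Fst).
have chV := chart_sym ch; split.
- by move=> x; rewrite /flip_chain; case: (F _); [apply: chart_bot2 ch _|apply: chart_bot1 ch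
    _].
- by move=> x; rewrite /flip_chain; case: (F _); [apply: chart_bot1 ch _|apply: chart_bot2 ch
    _].
- by move=> x; rewrite /flip_chain; case: (F _); [apply: chart_top2 ch _|apply: chart_top1 ch
    _].
- by move=> x; rewrite /flip_chain; case: (F _); [apply: chart_top1 ch _|apply: chart_top2 ch
    _].
- by move=> m; apply: flip_chain_leS ch Fs.
- by move=> m; apply: flip_chain_leS chV FsV.
- move=> x; have [i [j ->]] := chart_join ch x.
  (* When [F] differs at [i] and [j], a cut between them gives [f i <= g j]. The join is then a
     single chain element, and the other index can be 0, the bottom. *)
  have one k f g : @chart d L h k f g -> cut_constant k F -> forall i j, (i <= j)%N ->
      exists a b, f i `|` g j = flip_chain F f g a `|` flip_chain F g f b.
    move=> chk Fk {i j} i j ij; have [Fij|Fij] := eqVneq (F i) (F j).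
      case Fi: (F i); last by exists i, j; rewrite /flip_chain -Fij Fi.
      by exists j, i; rewrite /flip_chain -Fij Fi joinC.
    have [m [/andP[im mj] km]] := cut_constantP Fk Fij ij.
    have fg : f i <= g j.
      apply: le_trans (chart_homo1 chk (ltnW im)) _.
      by rewrite (chart_cut_eq chk km) (chart_homo2 chk).
    have bot0 y : flip_chain F f g 0 <= y /\ flip_chain F g f 0 <= y.
      by rewrite /flip_chain; case: (F 0); rewrite (chart_bot1 chk) (chart_bot2 chk).
    case Fj: (F j).
      by exists j, 0; rewrite (join_r fg) (join_l (proj2 (bot0 _))) /flip_chain Fj.
    by exists 0, j; rewrite (join_r fg) (join_r (proj1 (bot0 _))) /flip_chain Fj.
  have [ij|ji] := leqP i j; first exact: one ch Fs _ _ ij.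
  by have [a [b E]] := one _ _ _ chV FsV _ _ (ltnW ji); exists b, a; rewrite joinC E joinC.
- exact: flip_chart_perm ch Fst.
by move=> j i; rewrite joinC; apply: flip_chart_perm chV (flipsVV Fst) _ _.
Qed.

End ChartUniqueness.

(** * Realization of permutations *)

Section Realization.
Context (h : nat) (s : 'S_h).

(* [(k, l)] is the largest pair with join [c_k v e_l]. *)
Definition closed_pair (u : 'I_h.+1 * 'I_h.+1) : bool :=
  [forall i : 'I_h, (i == u.1 :> nat) ==> (u.2 <= s i)]
  && [forall j : 'I_h, (j == u.2 :> nat) ==> (u.1 <= s^-1%g j)].

Definition perm_lattice : Type := {u : 'I_h.+1 * 'I_h.+1 | closed_pair u}.

HB.instance Definition _ := Finite.on perm_lattice.

Implicit Types u v w : perm_lattice.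

Definition coord1 u : nat := (val u).1.
Definition coord2 u : nat := (val u).2.

Lemma coord1_le u : coord1 u <= h.
Proof. by rewrite -ltnS ltn_ord. Qed.

Lemma coord2_le u : coord2 u <= h.
Proof. by rewrite -ltnS ltn_ord. Qed.

Definition pl_le u v : bool := (coord1 u <= coord1 v) && (coord2 u <= coord2 v).

Lemma pl_le_refl : reflexive pl_le.
Proof. by move=> u; rewrite /pl_le !leqnn. Qed.

Lemma pl_le_anti : antisymmetric pl_le.
Proof.
move=> u v; rewrite /pl_le => /andP[/andP[u1 u2] /andP[v1 v2]]; apply/val_inj.
rewrite (surjective_pairing (val u)) (surjective_pairing (val v)).
by congr (_, _); apply/val_inj/eqP; rewrite eqn_leq ?[X in X && _]u1 ?[X in X && _]u2.
Qed.

Lemma pl_le_trans : transitive pl_le.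
Proof.
move=> v u w /andP[uv1 uv2] /andP[vw1 vw2].
by rewrite /pl_le (leq_trans uv1 vw1) (leq_trans uv2 vw2).
Qed.

Definition omin n (i j : 'I_n) : 'I_n := if i <= j then i else j.

Lemma val_omin n (i j : 'I_n) : omin i j = minn i j :> nat.
Proof. by rewrite /omin; case: ifP; lia. Qed.

Lemma closed_pairP (u : 'I_h.+1 * 'I_h.+1) : reflect
  ((forall i : 'I_h, i = u.1 :> nat -> u.2 <= s i) /\
   (forall j : 'I_h, j = u.2 :> nat -> u.1 <= s^-1%g j)) (closed_pair u).
Proof.
apply: (iffP andP) => -[/= H1 H2]; split.
- by move=> i /eqP iu; have /forallP/(_ i) := H1; rewrite iu.
- by move=> j /eqP ju; have /forallP/(_ j) := H2; rewrite ju.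
- by apply/forallP => i; apply/implyP => /eqP/H1.
- by apply/forallP => i; apply/implyP => /eqP/H2.
Qed.

(** Each coordinate of the minimum comes from one of the two pairs, while the other coordinate can
    only decrease. Hence closed pairs form a closure system. *)
Lemma closed_min (u v : 'I_h.+1 * 'I_h.+1) : closed_pair u -> closed_pair v ->
  closed_pair (omin u.1 v.1, omin u.2 v.2).
Proof.
move=> /closed_pairP[u1 u2] /closed_pairP[v1 v2]; apply/closed_pairP; split=> x /=;
  rewrite !val_omin => xE.
  case: (leqP u.1 v.1) => uv.
    by have := u1 x; move: xE; rewrite (minn_idPl uv) => -> /(_ erefl); lia.
  by have := v1 x; move: xE; rewrite (minn_idPr (ltnW uv)) => -> /(_ erefl); lia.
case: (leqP u.2 v.2) => uv.
  by have := u2 x; move: xE; rewrite (minn_idPl uv) => -> /(_ erefl); lia.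
by have := v2 x; move: xE; rewrite (minn_idPr (ltnW uv)) => -> /(_ erefl); lia.
Qed.

Definition pl_meet u v : perm_lattice := exist closed_pair _ (closed_min (valP u) (valP v)).

Lemma coord1_meet u v : coord1 (pl_meet u v) = minn (coord1 u) (coord1 v).
Proof. exact: val_omin. Qed.

Lemma coord2_meet u v : coord2 (pl_meet u v) = minn (coord2 u) (coord2 v).
Proof. exact: val_omin. Qed.

Lemma pl_meetP u v w : pl_le u (pl_meet v w) = pl_le u v && pl_le u w.
Proof. by rewrite /pl_le coord1_meet coord2_meet; lia. Qed.

Lemma closed_top : closed_pair (ord_max, ord_max).
Proof. by apply/closed_pairP; split=> x /= xh; have := ltn_ord x; rewrite xh ltnn. Qed.

Definition pl_top : perm_lattice := exist closed_pair _ closed_top.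

Definition pl_above (k l : nat) u : bool := (k <= (coord1 u)) && (l <= (coord2 u)).

(** The least closed pair above [(k, l)]: by stability under minima it is the meet of one with
    minimal first and one with minimal second coordinate. The default [pl_top] qualifies whenever
    [k, l <= h]. *)
Definition pl_closure (k l : nat) : perm_lattice :=
  pl_meet [arg min_(u < pl_top | pl_above k l u) (coord1 u)]
          [arg min_(u < pl_top | pl_above k l u) (coord2 u)].

Lemma pl_closureP k l u : k <= h -> l <= h -> pl_le (pl_closure k l) u = pl_above k l u.
Proof.
move=> kh lh; have ab : pl_above k l pl_top by rewrite /pl_above kh lh.
rewrite /pl_closure; case: arg_minnP => // v /andP[vk vl] vmin.
case: arg_minnP => // w /andP[wk wl] wmin.
apply/idP/idP; rewrite /pl_le /pl_above coord1_meet coord2_meet; first by lia.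
by move=> uP; have := vmin u uP; have := wmin u uP; lia.
Qed.

Definition pl_join u v : perm_lattice :=
  pl_closure (maxn (coord1 u) (coord1 v)) (maxn (coord2 u) (coord2 v)).

Lemma pl_joinP u v w : pl_le (pl_join u v) w = pl_le u w && pl_le v w.
Proof.
rewrite pl_closureP ?geq_max ?coord1_le ?coord2_le //.
by rewrite /pl_above /pl_le !geq_max; lia.
Qed.

Fact pl_display : Order.disp_t.
Proof. exact: Order.Disp tt tt. Qed.

HB.instance Definition _ :=
  Order.Le_isPOrder.Build pl_display perm_lattice pl_le_refl pl_le_anti pl_le_trans.
HB.instance Definition _ :=
  Order.POrder_MeetJoin_isLattice.Build pl_display perm_lattice pl_meetP pl_joinP.

Local Open Scope order_scope.

Lemma pl_leE u v : (u <= v) = pl_le u v.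
Proof. by []. Qed.

Lemma pl_closure_join k l k' l' :
  (k <= h)%N -> (l <= h)%N -> (k' <= h)%N -> (l' <= h)%N ->
  pl_closure k l `|` pl_closure k' l' = pl_closure (maxn k k') (maxn l l').
Proof.
move=> kh lh kh' lh'.
have le w : (pl_closure k l `|` pl_closure k' l' <= w) =
    (pl_closure (maxn k k') (maxn l l') <= w).
  rewrite leUx !pl_leE !pl_closureP ?geq_max ?kh ?lh //.
  by rewrite /pl_above; lia.
by apply/le_anti/andP; split; [rewrite le|rewrite -le].
Qed.

Lemma pl_closure_val u : pl_closure (coord1 u) (coord2 u) = u.
Proof.
have le w : (pl_closure (coord1 u) (coord2 u) <= w) = (u <= w).
  by rewrite pl_leE pl_closureP ?coord1_le ?coord2_le.
by apply/le_anti/andP; split; [rewrite le|rewrite -le].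
Qed.

Lemma coord_closed u :
  (forall i : 'I_h, i = coord1 u :> nat -> coord2 u <= s i)%N /\
  (forall j : 'I_h, j = coord2 u :> nat -> coord1 u <= s^-1%g j)%N.
Proof. exact: closed_pairP (valP u). Qed.

Lemma closed_graph (i : 'I_h) : closed_pair (inord i, inord (s i)).
Proof.
have iE : (inord i : 'I_h.+1) = i :> nat by rewrite inordK // ltnS ltnW.
have sE : (inord (s i) : 'I_h.+1) = s i :> nat by rewrite inordK // ltnS ltnW.
apply/closed_pairP; split=> x /=; rewrite iE sE => /val_inj->//.
by rewrite permK.
Qed.

Definition pl_graph (i : 'I_h) : perm_lattice := exist closed_pair _ (closed_graph i).

Lemma coord1_graph i : coord1 (pl_graph i) = i.
Proof. by rewrite /coord1 /= inordK // ltnS ltnW. Qed.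

Lemma coord2_graph i : coord2 (pl_graph i) = s i.
Proof. by rewrite /coord2 /= inordK // ltnS ltnW. Qed.

Lemma pl_above_closure k l : (k <= h)%N -> (l <= h)%N -> pl_above k l (pl_closure k l).
Proof. by move=> kh lh; rewrite -pl_closureP // pl_le_refl. Qed.

(** If [j <= s i], the closed pair [(i, s i)] lies above [(i, j)], so the closure keeps the first
    coordinate [i]. If [s i < j], no closed pair above [(i, j)] has first coordinate [i]. *)
Lemma pl_above_perm1 (i : 'I_h) j : (j <= h)%N ->
  (pl_closure i.+1 0 <= pl_closure i j) = (s i < j)%N.
Proof.
move=> jh; have ih := ltnW (ltn_ord i).
rewrite pl_leE pl_closureP // /pl_above andbT.
have /andP[iu ju] := pl_above_closure ih jh.
have cl := pl_closureP (pl_graph i) ih jh; have [u1 _] := coord_closed (pl_closure i j).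
move: cl; rewrite /pl_le /pl_above coord1_graph coord2_graph leqnn /= => cl.
apply/idP/idP => H; first by rewrite ltnNge -cl; move: H; lia.
rewrite ltn_neqAle iu andbT; apply/eqP => iE; have := u1 i iE.
by move: H ju; lia.
Qed.

Lemma pl_above_perm2 (j : 'I_h) i : (i <= h)%N ->
  (pl_closure 0 j.+1 <= pl_closure i j) = (s^-1%g j < i)%N.
Proof.
move=> ih; have jh := ltnW (ltn_ord j).
rewrite pl_leE pl_closureP // /pl_above /=.
have /andP[iu ju] := pl_above_closure ih jh.
have cl := pl_closureP (pl_graph (s^-1%g j)) ih jh; have [_ u2] := coord_closed (pl_closure i
    j).
move: cl; rewrite /pl_le /pl_above coord1_graph coord2_graph permKV leqnn andbT => cl.
apply/idP/idP => H; first by rewrite ltnNge -cl; move: H; lia.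
rewrite ltn_neqAle ju andbT; apply/eqP => jE; have := u2 j jE.
by move: H iu; lia.
Qed.

Lemma perm_lattice_chart :
  @chart _ perm_lattice h s (fun i => pl_closure (minn i h) 0) (fun j => pl_closure 0 (minn j
      h)).
Proof.
have mh i : (minn i h <= h)%N by rewrite geq_minr.
(* A closed pair with one coordinate [h] is the top: a smaller second coordinate would force a value
   of [s] or of its inverse to be at least [h]. *)
have topP k l w : (k <= h)%N -> (l <= h)%N -> (k = h \/ l = h) -> w <= pl_closure k l.
  move=> kh lh kl; rewrite pl_leE; have /andP[ku lu] := pl_above_closure kh lh.
  have [u1 u2] := coord_closed (pl_closure k l).
  move: (coord1_le (pl_closure k l)) (coord2_le (pl_closure k l)); rewrite /pl_le.
  move: (coord1 _) (coord2 _) u1 u2 ku lu => a b u1 u2 ka lb ah bh.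
  have [-> ->] : (a = h /\ b = h)%N; last by rewrite coord1_le coord2_le.
  case: kl => kl.
    split; first by lia.
    apply/eqP; rewrite eqn_leq bh leqNgt; apply/negP => lt.
    by have := u2 (Ordinal lt) erefl; have := ltn_ord ((s^-1)%g (Ordinal lt)); lia.
  split; last by lia.
  apply/eqP; rewrite eqn_leq ah leqNgt; apply/negP => lt.
  by have := u1 (Ordinal lt) erefl; have := ltn_ord (s (Ordinal lt)); lia.
split.
- by move=> w; rewrite min0n pl_leE pl_closureP.
- by move=> w; rewrite min0n pl_leE pl_closureP.
- by move=> w; apply: topP => //; left; rewrite minnn.
- by move=> w; apply: topP => //; right; rewrite minnn.
- move=> i; rewrite pl_leE pl_closureP //.
  by have := pl_above_closure (mh i.+1) (leq0n h); rewrite /pl_above; lia.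
- move=> i; rewrite pl_leE pl_closureP //.
  by have := pl_above_closure (leq0n h) (mh i.+1); rewrite /pl_above; lia.
- move=> w; exists (coord1 w), (coord2 w).
  by rewrite pl_closure_join // maxn0 max0n !(minn_idPl _) ?pl_closure_val ?coord1_le
      ?coord2_le.
- move=> i j; rewrite (minn_idPl (ltn_ord i)) (minn_idPl (ltnW (ltn_ord i))).
  rewrite pl_closure_join ?(ltnW (ltn_ord i)) // maxn0 max0n pl_above_perm1 //.
  by have := ltn_ord (s i); lia.
move=> j i; rewrite (minn_idPl (ltn_ord j)) (minn_idPl (ltnW (ltn_ord j))).
rewrite pl_closure_join ?(ltnW (ltn_ord j)) // maxn0 max0n pl_above_perm2 //.
by have := ltn_ord (s^-1%g j); lia.
Qed.

Local Close Scope order_scope.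

Lemma num_invE : num_inv s = #|[set p : 'I_h * 'I_h | (p.1 < p.2) && (s p.2 < s p.1)]|.
Proof.
rewrite /num_inv -[RHS](card_imset _ (f := fun p : 'I_h * 'I_h => (s p.1, s p.2))).
  by apply: eq_card => x; apply/imsetP/imsetP => -[p]; rewrite ?inE => H ->; exists p;
      rewrite ?inE.
by move=> [a b] [a' b'] /= [/perm_inj-> /perm_inj->].
Qed.

(** Apart from [(h, h)] both coordinates of a closed pair are below [h]. Such pairs form the graph
    of [s], the set [A], or satisfy both strict inequalities of [B]; a pair [(a, b)] of [B]
    corresponds to the inversion at the positions [a] and [s^-1 b]. *)
Lemma card_perm_lattice : #|{: perm_lattice}| = (h + num_inv s).+1.
Proof.
pose A := [set p : 'I_h * 'I_h | s p.1 == p.2].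
pose B := [set p : 'I_h * 'I_h | (p.2 < s p.1) && (p.1 < s^-1%g p.2)].
pose f (p : 'I_h * 'I_h) : 'I_h.+1 * 'I_h.+1 := (widen_ord (leqnSn h) p.1, widen_ord (leqnSn
    h) p.2).
have injf : injective f by move=> [a b] [a' b'] [/= E E']; congr (_, _); apply/val_inj.
have cA : #|A| = h.
  rewrite -[RHS]card_ord -(card_imset _ (f := fun i : 'I_h => (i, s i)));
      last by move=> i j [].
  apply: eq_card => -[a b]; rewrite inE; apply/eqP/imsetP => [/= <-|[i _ [-> ->]]//].
  by exists a.
have cB : #|B| = num_inv s.
  rewrite num_invE -[RHS](card_imset _ (f := fun p : 'I_h * 'I_h => (p.1, s p.2))); last first.
    by move=> [a b] [a' b'] /= [-> /perm_inj->].
  apply: eq_card => -[a b]; rewrite inE /=; apply/andP/imsetP => [[ba ab]|[[a' b']]].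
    by exists (a, s^-1%g b); rewrite ?inE /= ?permKV ?ab.
  by rewrite inE /= => /andP[ab ba] [-> ->]; rewrite permK.
have AB : [disjoint A & B].
  by apply/pred0P => -[a b] /=; rewrite !inE /=; case: eqP => //= <-; rewrite ltnn.
have cAB : #|A :|: B| = h + num_inv s.
  rewrite -cB -[X in X + _]cA -cardsUI (_ : A :&: B = set0) ?cards0 ?addn0 //.
  by apply/eqP; rewrite setI_eq0.
have <- : #|(ord_max, ord_max) |: [set f p | p in A :|: B]| = (h + num_inv s).+1.
  rewrite cardsU1 (card_imset _ injf) cAB (_ : _ \notin _) //.
  apply/imsetP => -[p _ [E _]].
  by have := ltn_ord p.1; rewrite -E ltnn.
rewrite card_sig; apply: eq_card => -[a b].
rewrite inE [RHS]inE in_set1 orbC; apply/closed_pairP/orP => /=.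
  move=> [H1 H2]; have := ltn_ord a; have := ltn_ord b; rewrite !ltnS => bh ah.
  have [ah'|ha] := ltnP a h; have [bh'|hb] := ltnP b h.
  - left; apply/imsetP; exists (Ordinal ah', Ordinal bh'); last by congr (_, _); apply/val_inj.
    have := H1 (Ordinal ah') erefl; have := H2 (Ordinal bh') erefl.
    rewrite !inE /= leq_eqVlt => /predU1P[E _|lt].
      by rewrite (_ : Ordinal ah' = s^-1%g (Ordinal bh')) ?permKV ?eqxx //; apply: val_inj.
    rewrite leq_eqVlt => /predU1P[E|lt2]; last by rewrite lt lt2 orbT.
    by rewrite (_ : Ordinal bh' = s (Ordinal ah')) ?eqxx //; apply: val_inj.
  - by have := H1 (Ordinal ah') erefl; have := ltn_ord (s (Ordinal ah')); lia.
  - by have := H2 (Ordinal bh') erefl; have := ltn_ord (s^-1%g (Ordinal bh')); lia.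
  by right; apply/eqP; congr (_, _); apply/val_inj => /=; lia.
case=> [/imsetP[[i j]]|/eqP[-> ->]]; last first.
  by split=> x xh; have := ltn_ord x; rewrite xh ltnn.
rewrite !inE /= => H [-> ->]; split=> x /= /val_inj->.
  by case/orP: H => [/eqP->|/andP[/ltnW]].
by case/orP: H => [/eqP<-|/andP[_ /ltnW]//]; rewrite permK.
Qed.

End Realization.

(** * Inversions and involutions *)

Section Inversions.
Local Open Scope group_scope.

Lemma isomorphic_card d d' (L : finLatticeType d) (M : finLatticeType d') :
  isomorphic L M -> #|L| = #|M|.
Proof.
case/existsP=> f /and3P[/injectiveP inj /forallP surj _].
rewrite -(card_codom inj); apply: eq_card => y; exact: surj.
Qed.

Lemma sim_isomorphic h (s t : 'S_h) : sim s t ->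
  isomorphic (perm_lattice s) (perm_lattice t).
Proof.
case=> F Fst; apply: chart_isomorphic (perm_lattice_chart t).
exact: chart_flips (perm_lattice_chart s) Fst.
Qed.

(** Isomorphic lattices have equal size, and the size reveals the number of inversions. *)
Lemma sim_num_inv h (s t : 'S_h) : sim s t -> num_inv t = num_inv s.
Proof.
by move/sim_isomorphic/isomorphic_card; rewrite !card_perm_lattice => -[/addnI].
Qed.

Lemma num_invV h (s : 'S_h) : num_inv s^-1 = num_inv s.
Proof. exact: sim_num_inv (simV s). Qed.

Lemma num_inv_sum h (s : 'S_h) :
  num_inv s = (\sum_(a < h) \sum_(b < h) ((a < b) && (s b < s a)))%N.
Proof.
rewrite num_invE -sum1_card pair_big /= -big_mkcond /=.
by apply: eq_bigl => -[a b]; rewrite inE.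
Qed.

Lemma ltn_lift h (i : 'I_h.+1) (a b : 'I_h) : (lift i a < lift i b) = (a < b).
Proof. by rewrite /= /bump; case: (leqP i a); case: (leqP i b); lia. Qed.

Lemma ltn_lift_self h (i : 'I_h.+1) (a : 'I_h) : (lift i a < i) = (a < i).
Proof. by rewrite /= /bump; case: (leqP i a); lia. Qed.

(** The value [j] in first place is inverted with exactly the [j] smaller values, which all come
    later; [lift] preserves the order of the rest. *)
Lemma num_inv_lift_perm h (j : 'I_h.+1) (s : 'S_h) :
  num_inv (lift_perm ord0 j s) = j + num_inv s.
Proof.
rewrite !num_inv_sum big_ord_recl big_ord_recl /= add0n; congr (_ + _).
  rewrite (eq_bigr (fun b => (s b < j) : nat)) => [|b _]; last first.
    by rewrite lift_perm_lift lift_perm_id ltn_lift_self.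
  have <- : \sum_(x < h) (x < j) = \sum_(b < h) (s b < j).
    by rewrite (reindex_inj (@perm_inj _ s)).
  rewrite -big_mkcond /= sum1_card; have jh : j <= h by rewrite -ltnS.
  rewrite -[RHS]card_ord -(card_imset predT (f := widen_ord jh)).
    apply: eq_card => x; apply/idP/imsetP => [xj|[y _ ->]]; last exact: ltn_ord y.
    by exists (Ordinal (xj : x < j)) => //; apply: val_inj.
  by move=> x y /(congr1 val) /= /val_inj.
apply: eq_bigr => a _; rewrite big_ord_recl /= add0n.
by apply: eq_bigr => b _; rewrite !lift_perm_lift ltn_lift.
Qed.

Lemma num_inv_lift_perm0 h (i : 'I_h.+1) (s : 'S_h) :
  num_inv (lift_perm i ord0 s) = i + num_inv s.
Proof. by rewrite -num_invV lift_permV num_inv_lift_perm num_invV. Qed.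

Lemma lift_perm_pair_bij h (i : 'I_h.+1) :
  bijective (fun u : 'I_h.+1 * 'S_h => lift_perm i u.1 u.2).
Proof.
apply: inj_card_bij => [[j s] [j' s'] /= E|].
  have jj : j = j' by rewrite -(lift_perm_id i j s) E lift_perm_id.
  rewrite -jj in E *; congr (_, _); apply/permP => x.
  by apply: (@lift_inj _ j); rewrite -!(lift_perm_lift i) E.
by rewrite card_prod card_ord !card_Sn factS.
Qed.

Lemma lift_permP h (i : 'I_h.+1) (s : 'S_h.+1) : exists j r, s = lift_perm i j r.
Proof.
by have [g _ /(_ s) <-] := lift_perm_pair_bij i; case: (g s) => j r; exists j, r.
Qed.

Lemma big_lift_perm (R : Type) (idx : R) (op : Monoid.com_law idx) h (i : 'I_h.+1)
    (F : 'S_h.+1 -> R) :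
  \big[op/idx]_s F s =
  \big[op/idx]_(j < h.+1) \big[op/idx]_(r : 'S_h) F (lift_perm i j r).
Proof. by rewrite pair_big (reindex _ (onW_bij _ (lift_perm_pair_bij i))). Qed.

Lemma num_inv_le h (s : 'S_h) : num_inv s <= 'C(h, 2).
Proof.
elim: h s => [|h IH] s; first by rewrite num_inv_sum big_ord0.
have [j [r ->]] := lift_permP ord0 s.
by rewrite num_inv_lift_perm binS bin1 addnC leq_add // -ltnS.
Qed.

Lemma num_inv_eq0 h (s : 'S_h) : (num_inv s == 0) = (s == 1).
Proof.
apply/eqP/eqP => [|->]; last first.
  rewrite num_inv_sum big1 // => a _; rewrite big1 // => b _.
  by rewrite !perm1; case: ltngtP.
elim: h s => [|h IH] s; first by move=> _; apply/permP => -[].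
have [j [r ->]] := lift_permP ord0 s; rewrite num_inv_lift_perm => /eqP.
rewrite addn_eq0 => /andP[/eqP j0 /eqP/IH->].
by rewrite (_ : j = ord0) ?lift_perm1 //; apply: val_inj.
Qed.

End Inversions.

Section GeneratingFunction.
Local Open Scope ring_scope.

Lemma sum_p_inv h : \sum_(0 <= j < 'C(h, 2).+1) (p h j)%:R *: 'X^j
  = \sum_(s : 'S_h) 'X^(num_inv s) :> {poly rat}.
Proof.
rewrite (partition_big (fun s : 'S_h => inord (num_inv s) : 'I_('C(h, 2).+1)) predT) //=.
rewrite big_mkord; apply: eq_bigr => j _.
have E (s : 'S_h) : (inord (num_inv s) == j) = (num_inv s == j).
  by rewrite -val_eqE /= inordK // ltnS num_inv_le.
rewrite (eq_bigr (fun=> 'X^j)) => [|s]; last by rewrite E => /eqP->.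
rewrite sumr_const scaler_nat; congr (_ *+ _); apply: eq_card => s.
by rewrite inE -E.
Qed.

Lemma prod_inv h : \sum_(s : 'S_h) 'X^(num_inv s)
  = \prod_(1 <= j < h.+1) \sum_(0 <= t < j) 'X^t :> {poly rat}.
Proof.
elim: h => [|h IH].
  rewrite big_geq // (big_pred1 1%g) => [|s]; first by rewrite num_inv_sum big_ord0.
  by rewrite /= -num_inv_eq0 num_inv_sum big_ord0.
rewrite (big_lift_perm _ ord0) big_nat_recr //= -IH mulrC big_mkord mulr_suml.
apply: eq_bigr => j _; rewrite mulr_sumr; apply: eq_bigr => s _.
by rewrite num_inv_lift_perm exprD.
Qed.

Lemma tofrac_prod_geometric h :
  tofrac (\prod_(1 <= j < h.+1) \sum_(0 <= t < j) 'X^t : {poly rat})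
    = \prod_(1 <= j < h.+1) (tofrac (1 - 'X^j) / tofrac (1 - 'X)).
Proof.
rewrite rmorph_prod; apply: eq_bigr => j _.
have X1 : tofrac (1 - 'X : {poly rat}) != 0.
  by rewrite tofrac_eq0 subr_eq0 eq_sym; apply/eqP => /(congr1 (fun q : {poly rat} => size
      q)); rewrite size_polyX size_poly1.
apply: (canRL (mulfK X1)); rewrite -rmorphM; congr tofrac.
rewrite big_mkord -[1 in RHS](expr1n _ j) subrXX mulrC; congr (_ * _).
by apply: eq_bigr => t _; rewrite expr1n mul1r.
Qed.

End GeneratingFunction.

Section Involutions.

Lemma invol_lift0 h (r : 'S_h) :
  (lift_perm ord0 ord0 r * lift_perm ord0 ord0 r == 1)%g = (r * r == 1)%g.
Proof.
rewrite lift_permM -(lift_perm1 (ord0 : 'I_h.+1)).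
apply/eqP/eqP => [E|->//]; apply/permP => x.
by apply: (@lift_inj _ ord0); rewrite -!(lift_perm_lift ord0) E.
Qed.

Lemma lift_lift0 h (j : 'I_h.+1) (x : 'I_h) :
  lift (lift ord0 j) (lift ord0 x) = lift ord0 (lift j x).
Proof. by apply/val_inj; rewrite /= /bump /= !add1n ltnS addnS. Qed.

(** [t] sends 0 to [j + 1], so an involution must send [j + 1] back to 0, which is [v = ord0]. What
    remains after deleting these two points is [r]. *)
Lemma invol_lift_swap h (j : 'I_h.+1) (v : 'I_h.+1) (r : 'S_h) :
  let t := lift_perm ord0 (lift ord0 j) (lift_perm j v r) in
  (t * t == 1)%g = (v == ord0) && (r * r == 1)%g.
Proof.
move=> t; have t0 : t ord0 = lift ord0 j by rewrite lift_perm_id.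
have tj : t (lift ord0 j) = lift (lift ord0 j) v by rewrite lift_perm_lift lift_perm_id.
have tx x : t (lift ord0 (lift j x)) = lift (lift ord0 j) (lift v (r x)).
  by rewrite !lift_perm_lift.
case: (eqVneq v ord0) => [v0|vN] /=; last first.
  apply/negbTE; apply: contra vN => /eqP/permP/(_ ord0).
  rewrite permM t0 tj perm1 => /(congr1 val) /= E; apply/eqP/val_inj => /=.
  by move: E; rewrite /bump; case: (_ <= _) => //; lia.
have tx' x : t (lift ord0 (lift j x)) = lift ord0 (lift j (r x)) by rewrite tx v0 lift_lift0.
have tj' : t (lift ord0 j) = ord0 by rewrite tj v0; apply/val_inj.
apply/eqP/eqP => E; apply/permP => x.
  have /permP/(_ (lift ord0 (lift j x))) := E.
  by rewrite permM !tx' !perm1 => /lift_inj/lift_inj; rewrite permM.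
rewrite permM perm1; case: (unliftP ord0 x) => [y ->|->]; last by rewrite t0 tj'.
case: (unliftP j y) => [z ->|->]; last by rewrite tj' t0.
by rewrite !tx' -permM E perm1.
Qed.

Lemma i_sum h k : i h k = \sum_(s : 'S_h) ((num_inv s == k) && (s * s == 1)%g).
Proof. by rewrite /i -sum1_card -big_mkcond /=; apply: eq_bigl => s; rewrite inE. Qed.

(** Either 0 is fixed, or it is exchanged with [j + 1]. The exchange contributes [(j + 1) + j]
    inversions; for [s = j + 2] this is the [2s - 3] of the stated formula. *)
Lemma i_rec h k : i h.+2 k =
  i h.+1 k + \sum_(j < h.+1) (if j.*2 < k then i h (k - j.*2.+1) else 0).
Proof.
rewrite !i_sum (big_lift_perm _ ord0) big_ord_recl; congr (_ + _).
  by apply: eq_bigr => s _; rewrite num_inv_lift_perm add0n invol_lift0.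
apply: eq_bigr => j _; rewrite (big_lift_perm _ j) (bigD1 ord0) //=.
rewrite [X in _ + X]big1 ?addn0 => [|v vN]; last first.
  by apply: big1 => r _; rewrite invol_lift_swap (negPf vN) andbF.
have E (r : 'S_h) : num_inv (lift_perm ord0 (lift ord0 j) (lift_perm j ord0 r)) = j.*2.+1 +
    num_inv r.
  by rewrite num_inv_lift_perm num_inv_lift_perm0 /= /bump; lia.
case: ltnP => [jk|kj]; last first.
  by apply: big1 => r _; rewrite E; case: eqP => //; lia.
rewrite i_sum; apply: eq_bigr => r _; rewrite E invol_lift_swap eqxx /=.
by congr (nat_of_bool (_ && _)); apply/eqP/eqP; lia.
Qed.

End Involutions.

(** * Direct sums of permutations *)

Section DirectSum.
Local Open Scope group_scope.
Context (m n : nat).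
Implicit Types (s : 'S_m) (t : 'S_n) (r : 'S_(m + n)).

Definition dsum_fun s t (x : 'I_(m + n)) : 'I_(m + n) :=
  match split x with inl a => lshift n (s a) | inr b => rshift m (t b) end.

Lemma split_lshift (a : 'I_m) : split (lshift n a) = inl a.
Proof. exact: (@unsplitK m n (inl a)). Qed.

Lemma split_rshift (b : 'I_n) : split (rshift m b) = inr b.
Proof. exact: (@unsplitK m n (inr b)). Qed.

Lemma dsum_funK s t : cancel (dsum_fun s t) (dsum_fun s^-1 t^-1).
Proof.
by move=> x; case: (split_ordP x) => y ->; rewrite /dsum_fun !(split_lshift, split_rshift)
    permK.
Qed.

Definition dsum s t : 'S_(m + n) := perm (can_inj (dsum_funK s t)).

Lemma dsum_lshift s t a : dsum s t (lshift n a) = lshift n (s a).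
Proof. by rewrite permE /dsum_fun split_lshift. Qed.

Lemma dsum_rshift s t b : dsum s t (rshift m b) = rshift m (t b).
Proof. by rewrite permE /dsum_fun split_rshift. Qed.

Lemma dsum_inj s t s' t' : dsum s t = dsum s' t' -> s = s' /\ t = t'.
Proof.
move=> E; split; apply/permP => x.
  by apply: (@lshift_inj m n); rewrite -(dsum_lshift _ t) E dsum_lshift.
by apply: (@rshift_inj m n); rewrite -(dsum_rshift s) E dsum_rshift.
Qed.

Lemma dsumM s t s' t' : dsum s t * dsum s' t' = dsum (s * s') (t * t').
Proof.
apply/permP => x; rewrite permM; case: (split_ordP x) => y ->.
  by rewrite !dsum_lshift permM.
by rewrite !dsum_rshift permM.
Qed.

Lemma dsum1 : dsum 1 1 = 1.
Proof.
apply/permP => x; rewrite perm1; case: (split_ordP x) => y ->.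
  by rewrite dsum_lshift perm1.
by rewrite dsum_rshift perm1.
Qed.

Lemma dsumV s t : (dsum s t)^-1 = dsum s^-1 t^-1.
Proof. by apply/eqP; rewrite eq_invg_mul dsumM !mulgV dsum1. Qed.

Lemma dsum_invol s t : (dsum s t * dsum s t == 1) = (s * s == 1) && (t * t == 1).
Proof.
rewrite dsumM; apply/eqP/andP => [|[/eqP-> /eqP->]]; last exact: dsum1.
by rewrite -dsum1 => /dsum_inj[-> ->].
Qed.

Lemma num_inv_dsum s t : num_inv (dsum s t) = (num_inv s + num_inv t)%N.
Proof.
rewrite !num_inv_sum big_split_ord /=; congr (_ + _); apply: eq_bigr => a _.
  rewrite big_split_ord /= [X in _ + X]big1 ?addn0 => [|b _]; last first.
    by rewrite dsum_lshift dsum_rshift /=; have := ltn_ord (s a); lia.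
  by apply: eq_bigr => b _; rewrite !dsum_lshift.
rewrite big_split_ord /= [X in X + _]big1 ?add0n => [|b _]; last first.
  by rewrite dsum_lshift dsum_rshift /=; have := ltn_ord b; lia.
by apply: eq_bigr => b _; rewrite !dsum_rshift /= !ltn_add2l.
Qed.

Lemma cut_dsuml s t j : j <= m -> cut (dsum s t) j = cut s j.
Proof.
move=> jm; apply/cutP/cutP => H x xj.
  by have := H (lshift n x) xj; rewrite dsum_lshift.
case: (split_ordP x) xj => y -> /= yj; first by rewrite dsum_lshift; apply: H.
by have := leq_trans yj jm; lia.
Qed.

Lemma cut_dsumr s t j : cut (dsum s t) (m + j) = cut t j.
Proof.
apply/cutP/cutP => H x xj.
  by have := H (rshift m x); rewrite dsum_rshift /= !ltn_add2l; apply.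
case: (split_ordP x) xj => y -> /= yj.
  by rewrite dsum_lshift /=; apply: ltn_addr.
by rewrite dsum_rshift /= ltn_add2l; apply: H; rewrite ltn_add2l in yj.
Qed.

Lemma cut_dsum r : cut r m -> exists s t, r = dsum s t.
Proof.
move=> rm.
have exl (a : 'I_m) : exists b : 'I_m, r (lshift n a) = lshift n b.
  have := cut_ltE (lshift n a) rm; rewrite /= ltn_ord.
  by case: (split_ordP (r _)) => b -> //=; exists b.
have exr (a : 'I_n) : exists b : 'I_n, r (rshift m a) = rshift m b.
  have := cut_ltE (rshift m a) rm; rewrite /= [RHS]ltnNge leq_addr /=.
  by case: (split_ordP (r _)) => b -> //=; exists b.
have [f fP] := fin_all_exists exl; have [g gP] := fin_all_exists exr.
have injf : injective f.
  by move=> a b E; apply: (@lshift_inj m n); apply: (@perm_inj _ r); rewrite !fP E.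
have injg : injective g.
  by move=> a b E; apply: (@rshift_inj m n); apply: (@perm_inj _ r); rewrite !gP E.
exists (perm injf), (perm injg); apply/permP => x; case: (split_ordP x) => y ->.
  by rewrite dsum_lshift permE.
by rewrite dsum_rshift permE.
Qed.

(** The length of the initial segment as a number, by which permutations can be sorted. *)
Definition first_cut h (r : 'S_h) (j : nat) : bool :=
  [&& 0 < j, cut r j & [forall l : 'I_j, (0 < l) ==> ~~ cut r l]].

Lemma first_cut_dsum s t : first_cut (dsum s t) m = irreducible [set: 'I_m] s.
Proof.
rewrite irreducibleE /first_cut cut_dsuml // cut_ge //=; congr (_ && _).
by apply: eq_forallb => l; rewrite cut_dsuml // ltnW.
Qed.

Lemma irreducibleP s : irreducible [set: 'I_m] s ->
  0 < m /\ forall j, 0 < j < m -> ~~ cut s j.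
Proof.
rewrite irreducibleE => /andP[m0 /forallP H]; split=> // j /andP[j0 jm].
by have := H (Ordinal jm); rewrite /= j0.
Qed.

Lemma sim_irreducible s s' : irreducible [set: 'I_m] s -> sim s s' -> s' = s \/ s' = s^-1.
Proof.
move=> /irreducibleP[m0 nocut] [F Fss'].
have E x : s' x = (if F 0 then s^-1 else s) x.
  by rewrite (sim_segment Fss' nocut) // inE ltn_ord.
by case: (F 0) E => E; [right|left]; apply/permP.
Qed.

(** On an irreducible head a marking is constant, so [s'] is [s] or its inverse; the equality of
    sets says this. Conversely the boundary [m] is a cut, so the markings of head and body can be
    chosen independently. *)
Lemma sim_dsum s s' t t' :
  irreducible [set: 'I_m] s -> irreducible [set: 'I_m] s' ->
  sim (dsum s t) (dsum s' t') <-> [set s; s^-1] = [set s'; s'^-1] /\ sim t t'.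
Proof.
move=> irs irs'; split=> [[F [Fs tE]]|[E [G [Gt t'E]]]].
  split; last first.
    exists (fun j => F (m + j)); split=> [j tj|x]; first by rewrite addnS Fs // -addnS
        cut_dsumr.
    have := tE (rshift m x); rewrite dsumV !dsum_rshift /= => E.
    by apply: (@rshift_inj m n); rewrite E; case: ifP.
  have ss' : sim s s'.
    exists F; split=> [j sj|x].
      apply: Fs; case: (ltnP m j.+1) => [mj|jm]; last by rewrite cut_dsuml.
      by case/negP: sj; apply: cut_ge; apply: ltnW.
    have := tE (lshift n x); rewrite dsumV !dsum_lshift /= => E.
    by apply: (@lshift_inj m n); rewrite E; case: ifP.
  by case: (sim_irreducible irs ss') => ->; rewrite ?invgK // setUC.
have [m0 nocut] := irreducibleP irs.
have : s' \in [set s; s^-1] by rewrite E !inE eqxx.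
rewrite !inE => s'E.
exists (fun j => if j < m then s' != s else G (j - m)); split=> [j|x].
  move=> sj; case: (ltngtP j.+1 m) => [//|mj|jm]; last first.
    by rewrite jm -{2}(addn0 m) cut_dsumr cut0 in sj.
  rewrite subSn //; apply: Gt; apply: contra sj => tj.
  by rewrite -(cut_dsumr s) addnS subnKC in tj.
rewrite dsumV; case: (split_ordP x) => y -> /=.
  rewrite !dsum_lshift; case: (eqVneq s' s) s'E => [->|_ /= /eqP->] //.
by rewrite addKn !dsum_rshift t'E; case: ifP.
Qed.

End DirectSum.

Section Recursions.

Lemma first_cut_exists h (r : 'S_h) : 0 < h -> exists2 j, j <= h & first_cut r j.
Proof.
move=> h0; have [v [/andP[v0 vh] rv nocut]] := next_cut r h0.
exists v => //; rewrite /first_cut v0 rv; apply/forallP => l; apply/implyP => l0.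
by rewrite nocut // l0 /=.
Qed.

Lemma first_cut_uniq h (r : 'S_h) j j' : first_cut r j -> first_cut r j' -> j = j'.
Proof.
move=> /and3P[j0 rj /forallP H] /and3P[j'0 rj' /forallP H'].
case: (ltngtP j j') => // lt.
  by have := H' (Ordinal lt); rewrite /= j0 rj.
by have := H (Ordinal lt); rewrite /= j'0 rj'.
Qed.

Lemma card_by_first_cut h (A : {set 'S_h}) : 0 < h ->
  #|A| = \sum_(1 <= m < h.+1) #|[set r in A | first_cut r m]|.
Proof.
move=> h0; rewrite -sum1_card.
rewrite (eq_bigr (fun m => \sum_(r in A) (first_cut r m : nat))) => [|m _]; last first.
  rewrite -sum1_card -big_mkcondr /=; apply: eq_bigl => r; by rewrite inE.
rewrite exchange_big; apply: eq_bigr => r _.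
have [j jh rj] := first_cut_exists r h0; have /andP[j0 _] := rj.
rewrite (bigD1_seq j) ?iota_uniq ?mem_index_iota ?j0 //= rj big1 // => l lj.
by apply/eqP; rewrite eqb0; apply: contra lj => rl; rewrite (first_cut_uniq rl rj).
Qed.

Section Multiplicative.
(** Instantiated with all permutations for [p] and with involutions for [i]. *)
Variable Q : forall h, pred 'S_h.
Hypothesis Q_dsum : forall m n (s : 'S_m) (t : 'S_n), Q (dsum s t) = Q s && Q t.

Lemma card_first_cut m n k :
  #|[set r : 'S_(m + n) | ((num_inv r == k) && Q r) && first_cut r m]| =
  \sum_(0 <= t < k.+1) #|[set s : 'S_m | [&& num_inv s == t, Q s & irreducible [set: 'I_m] s]]|
     * #|[set s : 'S_n | (num_inv s == k - t) && Q s]|.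
Proof.
pose X := [set u : 'S_m * 'S_n |
   [&& num_inv u.1 + num_inv u.2 == k, Q u.1 && Q u.2 & irreducible [set: 'I_m] u.1]].
have -> : #|[set r : 'S_(m + n) | ((num_inv r == k) && Q r) && first_cut r m]| = #|X|.
  rewrite -(card_imset (f := fun u : 'S_m * 'S_n => dsum u.1 u.2)); last first.
    by move=> [s t] [s' t'] /= /dsum_inj[-> ->].
  apply: eq_card => r; apply/idP/imsetP => [|[[s t] + ->]]; rewrite !inE -?andbA.
    move=> /and3P[rk Qr fr]; have /and3P[_ rm _] := fr; have [s [t rE]] := cut_dsum rm.
    exists (s, t) => //; rewrite inE /= -num_inv_dsum -rE rk /= -Q_dsum -rE Qr /=.
    by rewrite -(first_cut_dsum s t) -rE.
  by rewrite /= num_inv_dsum Q_dsum first_cut_dsum -!andbA.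
rewrite -sum1_card big_mkord.
have small (u : 'S_m * 'S_n) : u \in X -> num_inv u.1 < k.+1.
  by rewrite inE ltnS => /and3P[/eqP<- _ _]; apply: leq_addr.
rewrite (partition_big (fun u : 'S_m * 'S_n => inord (num_inv u.1) : 'I_k.+1) predT) //=.
apply: eq_bigr => t _; rewrite sum1_card -cardsX; apply: eq_card => -[s r].
rewrite unfold_in /= [RHS]inE !inE /=.
apply/andP/andP => [[/[dup] H /and3P[/eqP kE /andP[Qs Qr] irs] /eqP tE]|].
  have sE : num_inv s = t.
    by rewrite -tE inordK //; apply: (small (s, r)); rewrite inE.
  have -> : num_inv r = k - t by move: kE; rewrite /= sE; lia.
  by rewrite sE !eqxx Qs irs Qr.
move=> [/and3P[/eqP sE Qs irs] /andP[/eqP rE Qr]]; have := ltn_ord t.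
rewrite ltnS => tk; rewrite sE rE subnKC // eqxx Qs Qr irs; split=> //.
by apply/eqP/val_inj; rewrite /= inordK.
Qed.

Lemma multiplicative_rec h k : 0 < h ->
  #|[set s : 'S_h | (num_inv s == k) && Q s]| =
  \sum_(1 <= m < h.+1) \sum_(0 <= t < k.+1)
    #|[set s : 'S_m | [&& num_inv s == t, Q s & irreducible [set: 'I_m] s]]|
     * #|[set s : 'S_(h - m) | (num_inv s == k - t) && Q s]|.
Proof.
move=> h0; rewrite (card_by_first_cut _ h0).
rewrite !big_nat; apply: eq_bigr => m /andP[m0]; rewrite ltnS => /subnKC.
move: (h - m) => n <-; rewrite -card_first_cut.
by apply: eq_card => r; rewrite !inE.
Qed.

End Multiplicative.

Lemma p_rec h k : 0 < h ->
  p h k = \sum_(1 <= m < h.+1) \sum_(0 <= t < k.+1) p_hat m t * p (h - m) (k - t).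
Proof.
move=> h0; have pE n l : p n l = #|[set s : 'S_n | (num_inv s == l) && true]|.
  by apply: eq_card => s; rewrite !inE andbT.
rewrite pE (@multiplicative_rec (fun _ => xpredT)) //.
by do 2![apply: eq_bigr => ? _]; rewrite pE.
Qed.

Lemma i_split_rec h k : 0 < h ->
  i h k = \sum_(1 <= m < h.+1) \sum_(0 <= t < k.+1) i_hat m t * i (h - m) (k - t).
Proof.
by move=> h0; rewrite /i (@multiplicative_rec (fun n s => (s * s == 1)%g)) // => *;
    apply: dsum_invol.
Qed.

(** The values of [f] stand for classes and [c] is an invariant of the classes. It serves to sort
    lattices by length, and blocks by first cut and by the inversions of the head. *)
Lemma card_imset_partition (T U : finType) (f : T -> U) (A : {set T}) (c : T -> nat) N :
  (forall x, x \in A -> c x < N) ->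
  (forall x y, x \in A -> y \in A -> f x = f y -> c x = c y) ->
  #|f @: A| = \sum_(v < N) #|f @: [set x in A | c x == v]|.
Proof.
move=> cN cf; rewrite -sum1_card.
rewrite (eq_bigr (fun v : 'I_N => \sum_(u in f @: A) ((u \in f @: [set x in A | c x == v]) :
    nat))); last first.
  move=> v _; rewrite -sum1_card -big_mkcondr /=; apply: eq_bigl => u.
  apply/idP/andP => [|[]//] uv; split=> //; case/imsetP: uv => x;
      rewrite inE => /andP[xA _] ->.
  exact: imset_f.
rewrite exchange_big; apply: eq_bigr => u /imsetP[x xA ->].
rewrite (bigD1 (Ordinal (cN x xA))) //= imset_f ?inE ?xA ?eqxx // big1 // => v vx.
apply/eqP; rewrite eqb0; apply: contra vx => /imsetP[y]; rewrite inE => /andP[yA /eqP cy] E.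
by apply/eqP/val_inj; rewrite /= -cy (cf x y).
Qed.

(** Used in both directions: two codings with the same fibres have equally many values. *)
Lemma leq_card_imset_comp (T U V : finType) (f : T -> U) (g : T -> V) (A : {set T}) :
  (forall x y, x \in A -> y \in A -> g x = g y -> f x = f y) -> #|f @: A| <= #|g @: A|.
Proof.
move=> gf; have [->|[x0 x0A]] := set_0Vmem A; first by rewrite !imset0 cards0.
pose k v := odflt x0 [pick x in A | g x == v].
have -> : f @: A = (f \o k) @: (g @: A); last exact: leq_imset_card.
rewrite -imset_comp; apply: eq_in_imset => x xA /=; rewrite /k.
case: pickP => [y /andP[yA /eqP gy]|/(_ x)]; last by rewrite xA eqxx.
by apply: gf => //=.
Qed.

Definition head_classes m t : {set {set 'S_m}} :=
  [set [set s; s^-1%g] | s in [set s : 'S_m | (num_inv s == t) && irreducible [set: 'I_m] s]].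

(** A class has two members that are no involutions, or a single one that is. Giving involutions
    weight 2 makes the total weight of every class equal to 2. *)
Lemma card_head_classes m t : 2 * #|head_classes m t| = p_hat m t + i_hat m t.
Proof.
pose J := [set s : 'S_m | (num_inv s == t) && irreducible [set: 'I_m] s].
have JV s : s \in J -> (s^-1)%g \in J.
  rewrite !inE num_invV => /andP[-> /=]; rewrite !irreducibleE => /andP[->] /forallP H.
  by apply/forallP => l; rewrite cutV.
have -> : p_hat m t + i_hat m t = \sum_(s in J) (1 + (s * s == 1)%g).
  rewrite big_split /= sum1_card; congr (_ + _).
  rewrite /i_hat -sum1_card -big_mkcondr; apply: eq_bigl => s.
  by rewrite !inE -andbA [X in _ && X]andbC.
rewrite (partition_big_imset (fun s : 'S_m => [set s; s^-1%g])) /= mulnC -sum_nat_const.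
apply: eq_bigr => _ /imsetP[s sJ ->].
have E r : ((r \in J) && ([set r; r^-1%g] == [set s; s^-1%g])) = (r \in [set s; s^-1%g]).
  apply/andP/idP => [[_ /eqP <-]|]; first by rewrite !inE eqxx.
  rewrite in_set2 => /orP[/eqP->|/eqP->]; first by rewrite sJ.
  by rewrite JV // invgK setUC.
rewrite (eq_bigl _ _ E); have [ss|ss] := eqVneq (s * s)%g 1%g.
  have -> : (s^-1)%g = s by apply/eqP; rewrite eq_invg_mul ss.
  by rewrite setUid big_set1 ss eqxx.
have sV : s != (s^-1)%g by rewrite eq_sym eq_invg_mul.
rewrite big_setU1 ?inE // big_set1 (negPf ss) /=.
suff -> : (s^-1 * s^-1 == 1)%g = false by [].
by rewrite -invMg -(inj_eq invg_inj) invgK invg1; apply/negbTE.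
Qed.

(** By [sim_dsum] the block of a direct sum with irreducible head amounts to the class of the head
    together with the block of the body, that is, [f] and [g] have the same fibres. *)
Lemma block_first_cut m n k :
  #|[set block r | r : 'S_(m + n) in [set r : 'S_(m + n) | (num_inv r == k) && first_cut r
      m]]| =
  \sum_(0 <= t < k.+1)
    #|head_classes m t| * p_tilde n (k - t).
Proof.
pose X := [set u : 'S_m * 'S_n |
   (num_inv u.1 + num_inv u.2 == k) && irreducible [set: 'I_m] u.1].
pose f (u : 'S_m * 'S_n) := block (dsum u.1 u.2).
pose g (u : 'S_m * 'S_n) := ([set u.1; u.1^-1%g], block u.2).
have -> : [set block r | r : 'S_(m + n) in [set r : 'S_(m + n) | (num_inv r == k) &&
    first_cut r m]]
    = f @: X.
  apply/setP => B; apply/imsetP/imsetP => -[].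
    move=> r; rewrite inE => /andP[rk fr] ->.
    have /and3P[_ rm _] := fr; have [s [t rE]] := cut_dsum rm.
    exists (s, t); rewrite /f /= -?rE // inE /= -num_inv_dsum -rE rk /=.
    by rewrite -(first_cut_dsum s t) -rE.
  move=> [s t]; rewrite inE /= => /andP[st irs] ->; exists (dsum s t) => //.
  by rewrite inE num_inv_dsum st first_cut_dsum.
have irX u : u \in X -> irreducible [set: 'I_m] u.1 by rewrite inE => /andP[].
have fg u v : u \in X -> v \in X -> f u = f v <-> g u = g v.
  move=> /irX uX /irX vX; have := sim_dsum u.2 v.2 uX vX; rewrite /f /g => H; split.
    by move=> /eqP/block_eqP/H[-> /block_eqP/eqP->].
  by move=> [E /eqP/block_eqP s2]; apply/eqP/block_eqP/H.
have -> : #|f @: X| = #|g @: X|.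
  by apply/eqP; rewrite eqn_leq !leq_card_imset_comp // => u v uX vX; case: (fg u v uX vX).
rewrite (@card_imset_partition _ _ g X (fun u => num_inv u.1) k.+1); first last.
- move=> u v _ _ [E _]; have : u.1 \in [set v.1; v.1^-1%g] by rewrite -E !inE eqxx.
  by rewrite !inE => /orP[]/eqP->; rewrite ?num_invV.
- by move=> u; rewrite inE ltnS => /andP[/eqP<- _]; apply: leq_addr.
rewrite big_mkord; apply: eq_bigr => t _; rewrite /p_tilde -cardsX; apply: eq_card => -[B C].
have tk : t <= k by rewrite -ltnS.
rewrite [RHS]inE /=; apply/imsetP/andP => [[[s r]]|[/imsetP[s + ->] /imsetP[r + ->]]].
  rewrite !inE /= => /andP[/andP[/eqP sr irs] /eqP st] [-> ->].
  split; apply/imsetP; first by exists s; rewrite // inE st eqxx.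
  by exists r; rewrite // inE; apply/eqP; move: sr; rewrite st; lia.
rewrite !inE => /andP[/eqP st irs] /eqP rt; exists (s, r) => //.
by rewrite !inE /= st rt subnKC // !eqxx irs.
Qed.

Lemma p_tilde_rec h k : 0 < h ->
  2 * p_tilde h k = \sum_(1 <= m < h.+1) \sum_(0 <= t < k.+1)
    (p_hat m t + i_hat m t) * p_tilde (h - m) (k - t).
Proof.
move=> h0; have sub (r : 'S_h) : exists j, (j < h.+1) && first_cut r j.
  by have [j jh rj] := first_cut_exists r h0; exists j; rewrite ltnS jh.
pose c r := xchoose (sub r); have cP r : (c r < h.+1) && first_cut r (c r) := xchooseP (sub r).
have cE r m : (c r == m) = first_cut r m.
  apply/eqP/idP => [<-|rm]; first by case/andP: (cP r).
  by case/andP: (cP r) => _ rc; apply: first_cut_uniq rc rm.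
have -> : p_tilde h k = #|[set block r | r in [set r : 'S_h | num_inv r == k]]|.
  by rewrite /p_tilde; congr #|pred_of_set _|; apply: eq_imset => //; move=> r; rewrite inE.
rewrite (@card_imset_partition _ _ _ _ c h.+1); first last.
(* The first cut is an invariant of blocks because similar permutations have the same cuts. *)
- move=> r r' _ _ /eqP/block_eqP rr'; apply/eqP; rewrite cE;
    have /andP[_ /and3P[c0 cc /forallP H]] := cP r'.
  rewrite /first_cut c0 -(sim_cut _ rr') cc; apply/forallP => l.
  by rewrite -(sim_cut _ rr'); apply: H.
- by move=> r _; case/andP: (cP r).
rewrite -(big_mkord xpredT (fun m => #|[set block r | r in [set r in [set r : 'S_h | num_inv
    r == k] | c r == m]]|)).
(* A first cut is positive, so the term for 0 is empty. *)
rewrite big_nat_recl // [X in 2 * (X + _)](_ : _ = 0) ?add0n; last first.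
  apply/eqP; rewrite cards_eq0 -subset0; apply/subsetP => B /imsetP[r].
  by rewrite !inE cE /first_cut ltnn andbF.
rewrite [RHS]big_add1 /= big_distrr /= !big_nat; apply: eq_bigr => m mh.
rewrite (eq_bigr (fun t => 2 * (#|head_classes m.+1 t| * p_tilde (h - m.+1) (k - t))));
    last first.
  by move=> t _; rewrite mulnA card_head_classes.
rewrite -big_distrr /=; congr (2 * _).
have -> : [set r in [set r : 'S_h | num_inv r == k] | c r == m.+1] = [set r : 'S_h | (num_inv
    r == k) && first_cut r m.+1].
  by apply/setP => r; rewrite !inE cE.
move: mh => /subnKC; move: (h - m.+1) => n; clear; move=> <-; exact: block_first_cut.
Qed.

Lemma p0 h : p h 0 = 1.
Proof. by rewrite -(cards1 (1%g : 'S_h)); apply: eq_card => s; rewrite !inE num_inv_eq0. Qed.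

Lemma i0 h : i h 0 = 1.
Proof.
rewrite -(cards1 (1%g : 'S_h)); apply: eq_card => s; rewrite !inE num_inv_eq0.
by case: eqP => //= ->; rewrite mulg1 eqxx.
Qed.

Lemma p_tilde0 h : p_tilde h 0 = 1.
Proof.
rewrite -(cards1 (block (1%g : 'S_h))); apply: eq_card => B.
apply/imsetP/set1P => [[s + ->]| ->]; first by rewrite !inE num_inv_eq0 => /eqP->.
by exists 1%g; rewrite // !inE num_inv_eq0.
Qed.

Lemma irreducible1 (s : 'S_1) : irreducible [set: 'I_1] s.
Proof. by rewrite irreducibleE; apply/forallP => l; rewrite ord1. Qed.

Lemma p_hat10 : p_hat 1 0 = 1.
Proof. by rewrite -[RHS](p0 1); apply: eq_card => s; rewrite !inE irreducible1 andbT. Qed.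

Lemma i_hat10 : i_hat 1 0 = 1.
Proof. by rewrite -[RHS](i0 1); apply: eq_card => s; rewrite !inE irreducible1 andbT. Qed.

Lemma reducible1 h : 1 < h -> irreducible [set: 'I_h] 1%g = false.
Proof.
move=> h1; rewrite irreducibleE; apply/negbTE; rewrite negb_and; apply/orP; right.
apply/forallPn; exists (Ordinal h1); rewrite /= negbK; apply/cutP => x.
by rewrite perm1.
Qed.

Lemma p_hat0 h : 1 < h -> p_hat h 0 = 0.
Proof.
move=> h1; apply/eqP; rewrite cards_eq0; apply/eqP/setP => s; rewrite !inE num_inv_eq0.
by case: eqP => //= ->; rewrite reducible1.
Qed.

Lemma i_hat0 h : 1 < h -> i_hat h 0 = 0.
Proof.
move=> h1; apply/eqP; rewrite cards_eq0; apply/eqP/setP => s; rewrite !inE num_inv_eq0.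
by case: eqP => //= ->; rewrite reducible1 // andbF.
Qed.

Lemma vanishing_above h k : 'C(h, 2) < k ->
  [/\ p_tilde h k = 0, p h k = 0, p_hat h k = 0, i h k = 0 & i_hat h k = 0].
Proof.
move=> hk; have E (s : 'S_h) : (num_inv s == k) = false.
  by apply/negbTE; rewrite neq_ltn (leq_ltn_trans (num_inv_le s) hk).
split; apply/eqP; rewrite cards_eq0 -subset0; apply/subsetP => B; rewrite ?inE ?E //.
by move=> /imsetP[s]; rewrite inE E.
Qed.

End Recursions.

(** * Counting isomorphism classes *)

Section Counting.

Definition has_chart d (L : finLatticeType d) h (s : 'S_h) : Prop :=
  exists c e, @chart d L h s c e.

Lemma has_chart_sim d (L : finLatticeType d) h (s t : 'S_h) :
  has_chart L s -> sim s t -> has_chart L t.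
Proof.
by move=> [c [e ch]] [F Fst]; do 2!eexists; apply: chart_flips ch Fst.
Qed.

Lemma has_chart_card d (L : finLatticeType d) h (s : 'S_h) :
  has_chart L s -> #|L| = (h + num_inv s).+1.
Proof.
move=> [c [e ch]]; rewrite -card_perm_lattice.
exact: isomorphic_card (chart_isomorphic ch (perm_lattice_chart s)).
Qed.

Lemma has_chart_isomorphic d d' (L : finLatticeType d) (M : finLatticeType d') h (s : 'S_h) :
  has_chart L s -> isomorphic L M <-> has_chart M s.
Proof.
move=> [c [e ch]]; split=> [iso|[c' [e' ch']]]; last exact: chart_isomorphic ch ch'.
exact: chart_transport iso ch.
Qed.

Lemma has_chart_uniq d (L : finLatticeType d) h (s t : 'S_h) :
  has_chart L s -> has_chart L t -> sim s t.
Proof. by move=> [c [e ch]] [c' [e' ch']]; apply: chart_sim ch ch'. Qed.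

Lemma card_carrier n (r : lattice_on n) : #|{: carrier r}| = n.
Proof. exact: card_ord. Qed.

(** Classes are sorted by the length of the lattice; within one length, the block of a chosen chart
    permutation [code r] determines the class and conversely. Every block with [n - h - 1]
    inversions occurs, since the lattice of closed pairs then has [n] elements and can be copied to
    ['I_n]. *)
Lemma N_ssl_sum n : 0 < n -> N_ssl n = \sum_(h < n) p_tilde h (n - h - 1).
Proof.
move=> n0; rewrite /N_ssl /equivalence_partition.
set S := [set r : lattice_on n | _].
set f := fun r : lattice_on n => [set y in S | isomorphic (carrier r) (carrier y)].
have inS r h (s : 'S_h) : has_chart (carrier r) s -> r \in S.
  by move=> [c [e ch]]; rewrite inE (chart_slim ch) (chart_semimodular ch).
have exlen (r : lattice_on n) : exists h : 'I_n, r \in S -> exists s : 'S_h, has_chart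
    (carrier r) s.
  have [|rNS] := boolP (r \in S); last by exists (Ordinal n0).
  rewrite inE => /andP[sl sm].
  have [h [s [c [e ch]]]] := chart_exists (Ordinal n0 : carrier r) sl sm.
  have hn : h < n.
    rewrite -{1}(card_carrier r) (@has_chart_card _ _ h s); last by exists c, e.
    by rewrite ltnS leq_addr.
  by exists (Ordinal hn) => _; exists s, c, e.
have [len lenP] := fin_all_exists exlen.
have lenE r h (s : 'S_h) : has_chart (carrier r) s -> len r = h :> nat.
  move=> hs; have [t [c [e ch]]] := lenP r (inS _ _ _ hs); have [c' [e' ch']] := hs.
  exact: chart_length ch ch'.
have refl r : r \in S -> r \in f r.
  move=> rS; have [t ht] := lenP r rS; rewrite inE rS /=.
  exact/(has_chart_isomorphic _ ht).
rewrite (@card_imset_partition _ _ f S (fun r => len r) n) //; last first.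
  move=> r r' rS r'S E; have := refl r' r'S; rewrite -E inE => /andP[_ iso].
  have [t ht] := lenP r rS; apply/esym/lenE; exact/(has_chart_isomorphic _ ht)/iso.
apply: eq_bigr => h _; set Sh := [set x in S | _].
have excode (r : lattice_on n) : exists s : 'S_h, r \in Sh -> has_chart (carrier r) s.
  have [|rNS] := boolP (r \in Sh); last by exists 1%g.
  rewrite inE => /andP[rS]; have := lenP r rS; case=> s hs /eqP rh.
  by move: s hs; rewrite rh => s hs; exists s.
have [code codeP] := fin_all_exists excode.
have ShS r : r \in Sh -> r \in S by rewrite inE => /andP[].
pose g r := block (code r).
have fg r r' : r \in Sh -> r' \in Sh -> f r = f r' <-> g r = g r'.
  move=> rS r'S; have hr := codeP r rS; have hr' := codeP r' r'S; split=> [E|].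
    have := refl r' (ShS _ r'S); rewrite -E inE => /andP[_ /(has_chart_isomorphic _ hr) hs].
    by apply/eqP/block_eqP; apply: has_chart_uniq hs hr'.
  move=> /eqP/block_eqP ss; apply/setP => y; rewrite !inE; congr (_ && _).
  apply/idP/idP => /has_chart_isomorphic H.
    by apply/(has_chart_isomorphic _ hr'); apply: has_chart_sim (H _ _ hr) ss.
  by apply/(has_chart_isomorphic _ hr); apply: has_chart_sim (H _ _ hr') (sim_sym ss).
transitivity #|g @: Sh|.
  apply/eqP; rewrite eqn_leq; apply/andP; split; apply: leq_card_imset_comp => r r' rS r'S.
    by case: (fg r r' rS r'S).
  by case: (fg r r' rS r'S).
apply: eq_card => B; apply/imsetP/imsetP => [[r rS ->]|[s + ->]].
  exists (code r) => //; rewrite inE.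
  have := has_chart_card (codeP r rS); rewrite card_carrier => nE.
  by apply/eqP; move: nE; have := ltn_ord h; lia.
rewrite inE => /eqP sE.
have cardP : #|{: perm_lattice s}| = n by rewrite card_perm_lattice sE; have := ltn_ord h; lia.
have [r iso] := lattice_on_complete cardP.
have hs : has_chart (carrier r) s.
  have hp : has_chart (perm_lattice s) s by do 2!eexists; apply: perm_lattice_chart.
  exact/(has_chart_isomorphic _ hp)/iso.
have rSh : r \in Sh by rewrite inE (inS _ _ _ hs) /= (lenE _ _ _ hs) eqxx.
by exists r => //; apply/eqP/block_eqP; apply: has_chart_uniq hs (codeP r rSh).
Qed.

End Counting.

(** * The recursion and its uniqueness *)

Section Recursion.
Local Open Scope ring_scope.

Lemma convolution_split (f g : nat -> nat -> nat) h k :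
  \sum_(1 <= s < h.+2) \sum_(0 <= t < k.+1)
     extend_by_0 f s t * extend_by_0 g (h.+1%:Z - s%:Z) (k%:Z - t%:Z) =
  (\sum_(1 <= s < h.+2) \sum_(0 <= t < k.+1) f s t * g (h.+1 - s)%N (k - t)%N)%N%:R.
Proof.
rewrite natr_sum !big_nat; apply: eq_bigr => s /andP[_ sh].
rewrite natr_sum !big_nat; apply: eq_bigr => t /andP[_ tk].
by rewrite ltnS in sh; rewrite ltnS in tk; rewrite natrM !subzn.
Qed.

(** In the convolution the term with [s = h + 1] reduces to the value of [fh] at [h + 1] and [k],
    because [f 0] is 1 at 0 and vanishes elsewhere. Moving the other terms to the left gives the
    recursion. *)
Lemma hat_formula (f fh : nat -> nat -> nat) h k :
  (forall l, (0 < l)%N -> f 0%N l = 0%N) -> f 0%N 0%N = 1%N ->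
  f h.+1 k = (\sum_(1 <= s < h.+2) \sum_(0 <= t < k.+1) fh s t * f (h.+1 - s)%N (k - t)%N)%N ->
  extend_by_0 fh h.+1 k = extend_by_0 f h.+1 k -
    \sum_(1 <= s < h.+1) \sum_(0 <= t < k.+1)
      extend_by_0 fh s t * extend_by_0 f (h.+1%:Z - s%:Z) (k%:Z - t%:Z).
Proof.
move=> f0 f00 fE; apply/eqP; rewrite eq_sym subr_eq addrC; apply/eqP.
have := convolution_split fh f h k.
rewrite -fE big_nat_recr //= => <-; congr (_ + _).
have f00' : extend_by_0 f 0 0 = 1 by rewrite /= f00.
rewrite big_nat_recr //= !subrr f00' mulr1 big1_seq ?add0r // => t.
rewrite mem_index_iota => /andP[_ tk].
by rewrite subzn ?(ltnW tk) //= f0 ?mulr0 // subn_gt0.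
Qed.

Lemma recursion_holds :
  ssl_recursion (fun n => (N_ssl n)%:R)
    (extend_by_0 p) (extend_by_0 p_hat) (extend_by_0 i) (extend_by_0 i_hat)
    (extend_by_0 p_tilde).
Proof.
split.
- move=> h h0; split; last exact: tofrac_prod_geometric.
  by rewrite -prod_inv -sum_p_inv.
- move=> n n0; rewrite N_ssl_sum // natr_sum big_mkord; apply: eq_bigr => h _.
  suff -> : n%:Z - h%:Z - 1 = (n - h - 1)%N by [].
  by have := ltn_ord h; lia.
- case=> // h k _.
  have -> : \sum_(1 <= s < h.+2) \sum_(0 <= t < k.+1)
      (extend_by_0 p_hat s t + extend_by_0 i_hat s t)
      * extend_by_0 p_tilde (h.+1%:Z - s%:Z) (k%:Z - t%:Z) = (2 * p_tilde h.+1 k)%N%:R.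
    rewrite p_tilde_rec //.
    rewrite -(convolution_split (fun s t => p_hat s t + i_hat s t)%N p_tilde).
    by do 2![apply: eq_bigr => ? _]; rewrite /= natrD.
  by rewrite natrM mulrA divrK ?mul1r // unitfE.
- case=> // h k _; apply: hat_formula; rewrite ?p0 //; last exact: p_rec.
  by move=> l l0; have [] := @vanishing_above 0 l l0.
- move=> [|[|h]] k // _.
    (* For [h = 1] the sum is empty, and the involutions of degrees 0 and 1 have equal counts. *)
    rewrite big_geq // addr0 /=; congr _%:R.
    case: k => [|k]; first by rewrite !i0.
    have [_ _ _ -> _] := @vanishing_above 1 k.+1 isT.
    by have [_ _ _ -> _] := @vanishing_above 0 k.+1 isT.
  rewrite [LHS]/= i_rec natrD; congr (_ + _).
  rewrite natr_sum big_add1 big_add1 big_mkord; apply: eq_bigr => j _.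
  have -> : h.+2%:Z - 2 = h by lia.
  case: ltnP => jk.
    have -> : k%:Z - 2 * j.+2%:Z + 3 = (k - j.*2.+1)%N by lia.
    by [].
  (* Here the second argument is negative, and the extension by 0 matches the zero branch of
     [i_rec]. *)
  by case E : (k%:Z - 2 * j.+2%:Z + 3) => [l|l] //; lia.
- case=> // h k _; apply: hat_formula; rewrite ?i0 //; last exact: i_split_rec.
  by move=> l l0; have [] := @vanishing_above 0 l l0.
- by move=> h; rewrite /= p_tilde0 p0 i0.
- by rewrite /= p_hat10 i_hat10.
- by move=> h k hk; rewrite /=; have [-> -> -> -> ->] := vanishing_above hk.
- by move=> [h|h] [k|k].
- by move=> h h1; rewrite /= p_hat0 // i_hat0.
Qed.

Section Uniqueness.
Variables (N N' : nat -> rat) (q qh j jh qt q' qh' j' jh' qt' : int -> int -> rat).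
Hypotheses (H : ssl_recursion N q qh j jh qt) (H' : ssl_recursion N' q' qh' j' jh' qt').

(** Coefficients of the common product are compared for [k] up to the degree bound and [h > 0];
    larger [k] fall under the vanishing conditions and [h = 0] under the initial values. *)
Lemma recursion_p (h k : nat) : q h k = q' h k.
Proof.
have [hk|kh] := ltnP 'C(h, 2) k.
  have [_ -> _ _ _] := vanishing_large H hk.
  by have [_ -> _ _ _] := vanishing_large H' hk.
case: h kh => [|h] kh.
  move: kh; rewrite leqn0 => /eqP->.
  by have [_ [-> _]] := initial_one H 0; have [_ [-> _]] := initial_one H' 0.
have [E _] := generating_function H (ltn0Sn h).
have [E' _] := generating_function H' (ltn0Sn h).
have coefE (f : nat -> rat) n : (k < n)%N -> (\sum_(0 <= l < n) f l *: 'X^l)`_k = f k.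
  by move=> kn; rewrite big_mkord -(poly_def n f) coef_poly kn.
have /polyP/(_ k) := etrans E (esym E').
by rewrite (coefE (fun l : nat => q h.+1 l)) // (coefE (fun l : nat => q' h.+1 l)).
Qed.

Lemma recursion_hat (f fh f' fh' : int -> int -> rat) :
  (forall h k : nat, f h k = f' h k) ->
  (forall h k : nat, (0 < h)%N ->
    fh h k = f h k - \sum_(1 <= s < h) \sum_(0 <= t < k.+1)
        fh s t * f (h%:Z - s%:Z) (k%:Z - t%:Z)) ->
  (forall h k : nat, (0 < h)%N ->
    fh' h k = f' h k - \sum_(1 <= s < h) \sum_(0 <= t < k.+1)
        fh' s t * f' (h%:Z - s%:Z) (k%:Z - t%:Z)) ->
  forall h k : nat, (0 < h)%N -> fh h k = fh' h k.
Proof.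
move=> ff E E' h; elim/ltn_ind: h => h IH k h0; rewrite E // E' // ff.
congr (_ - _); rewrite !big_nat; apply: eq_bigr => s /andP[s0 sh].
rewrite !big_nat; apply: eq_bigr => t /andP[_ tk].
by rewrite IH // !subzn ?ff // ltnW.
Qed.

Lemma recursion_i (h k : nat) : j h k = j' h k.
Proof.
elim/ltn_ind: h k => -[|h] IH k.
  case: k => [|k].
    by have [_ [_ ->]] := initial_one H 0; have [_ [_ ->]] := initial_one H' 0.
  have [_ _ _ -> _] := @vanishing_large _ _ _ _ _ _ H 0 k.+1 isT.
  by have [_ _ _ -> _] := @vanishing_large _ _ _ _ _ _ H' 0 k.+1 isT.
rewrite (i_formula H) // (i_formula H') //; congr (_ + _).
  have -> : h.+1%:Z - 1 = h by lia.
  exact: IH.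
rewrite !big_nat; apply: eq_bigr => s /andP[s2 sh].
have -> : h.+1%:Z - 2 = h.-1 by lia.
case: (_ + 3) => l; first by apply: IH; lia.
have [_ _ _ -> _] := @vanishing_negative _ _ _ _ _ _ H h.-1%:Z (Negz l) isT.
by have [_ _ _ -> _] := @vanishing_negative _ _ _ _ _ _ H' h.-1%:Z (Negz l) isT.
Qed.

Lemma recursion_p_tilde (h k : nat) : qt h k = qt' h k.
Proof.
elim/ltn_ind: h k => -[|h] IH k.
  case: k => [|k].
    by have [-> _] := initial_one H 0; have [-> _] := initial_one H' 0.
  have [-> _ _ _ _] := @vanishing_large _ _ _ _ _ _ H 0 k.+1 isT.
  by have [-> _ _ _ _] := @vanishing_large _ _ _ _ _ _ H' 0 k.+1 isT.
rewrite (p_tilde_formula H) // (p_tilde_formula H') //; congr (_ * _).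
rewrite !big_nat; apply: eq_bigr => s /andP[s0 sh].
rewrite !big_nat; apply: eq_bigr => t /andP[_ tk].
rewrite (recursion_hat recursion_p (p_hat_formula H) (p_hat_formula H')) //.
rewrite (recursion_hat recursion_i (i_hat_formula H) (i_hat_formula H')) //.
by rewrite !subzn // IH //; lia.
Qed.

Lemma recursion_N n : (0 < n)%N -> N n = N' n.
Proof.
move=> n0; rewrite (N_formula H) // (N_formula H') // !big_nat.
apply: eq_bigr => h /andP[_ hn].
have -> : n%:Z - h%:Z - 1 = (n - h - 1)%N by lia.
exact: recursion_p_tilde.
Qed.

End Uniqueness.
End Recursion.

Local Open Scope ring_scope.

(** That the formulas determine the numbers is expressed as uniqueness: the second part also lets
    all the auxiliary functions vary. *)
Theorem theorem3p2 :
  ssl_recursion (fun n => (N_ssl n)%:R)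
    (extend_by_0 p) (extend_by_0 p_hat) (extend_by_0 i) (extend_by_0 i_hat)
    (extend_by_0 p_tilde)
  /\
  (forall (N : nat -> rat) (q q_hat j j_hat q_tilde : int -> int -> rat),
     ssl_recursion N q q_hat j j_hat q_tilde ->
     forall n : nat, (0 < n)%N -> N n = (N_ssl n)%:R).
Proof.
split; first exact: recursion_holds.
move=> N q q_hat j j_hat q_tilde H n.
exact: recursion_N H recursion_holds n.
Qed.
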